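(* For every element $X\in \mathrm{Y}(\mathfrak q_N,h)$ one has the equality in $\mathrm U(\mathfrak g)^{\otimes 2}$ $$(\psi\otimes\psi)\bigl((\Delta(X)-\Delta^{\circ}(X))/h\bigr)=\varphi\bigl(\psi(X)\bigr).$$
   Context: Work over $\mathbb C$; fix $N\ge1$. Indices $i,j,k,l$ run over $\pm1,\dots,\pm N$; $\bar\imath=0$ if $i>0$ and $\bar\imath=1$ if $i<0$. Square brackets denote the supercommutator. Tensor products of $\mathbb Z_2$-graded algebras have multiplication $(X\otimes Y)(X'\otimes Y')=XX'\otimes YY'\cdot(-1)^{\deg X'\deg Y}$, and $\theta(X\otimes Y)=Y\otimes X\cdot(-1)^{\deg X\deg Y}$. $\mathbb C^{N|N}$ has basis $e_i$ with $\deg e_i=\bar\imath$; $E_{ij}$ are the matrix units, $\deg E_{ij}=\bar\imath+\bar\jmath$, also viewed as generators of the Lie superalgebra $\mathfrak{gl}_{N|N}$. Let $\eta(E_{ij})=E_{-i,-j}$. Yangian: $\mathrm Y(\mathfrak q_N)$ is the complex associative unital $\mathbb Z_2$-graded algebra with generators $T_{ij}^{(s)}$ ($s\ge1$), $\deg T^{(s)}_{ij}=\bar\imath+\bar\jmath$, and relations, where $T_{ij}(u)=\delta_{ij}+T^{(1)}_{ij}u^{-1}+T^{(2)}_{ij}u^{-2}+\cdots$, $$(u^2-v^2)[T_{ij}(u),T_{kl}(v)](-1)^{\bar\imath\bar k+\bar\imath\bar l+\bar k\bar l}=(u+v)\bigl(T_{kj}(u)T_{il}(v)-T_{kj}(v)T_{il}(u)\bigr)-(u-v)\bigl(T_{-k,j}(u)T_{-i,l}(v)-T_{k,-j}(v)T_{i,-l}(u)\bigr)(-1)^{\bar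 k+\bar l},$$ $$T_{ij}(-u)=T_{-i,-j}(u).$$ Its comultiplication is $\Delta(T_{ij}(u))=\sum_k T_{ik}(u)\otimes T_{kj}(u)\,(-1)^{(\bar\imath+\bar k)(\bar\jmath+\bar k)}$. Twisted current algebra: $\mathfrak g=\{X(u)\in\mathfrak{gl}_{N|N}[u]:\eta(X(u))=X(-u)\}$, spanned by $F^{(s)}_{ij}=E_{ij}u^s+E_{-i,-j}(-u)^s$, $s\ge0$. Co-Poisson structure: put $$r(u,v)=\sum_{ij}E_{ij}\otimes E_{ji}\frac{(-1)^{\bar\jmath}}{u-v}+\sum_{ij}E_{ij}\otimes E_{-j,-i}\frac{(-1)^{\bar\jmath}}{u+v}.$$ Define $\varphi:\mathfrak g\to\mathfrak g^{\otimes2}\subset\mathfrak{gl}_{N|N}[u]\otimes\mathfrak{gl}_{N|N}[v]$ by $\varphi(X(u))=[X(u)\otimes1+1\otimes X(v),\,r(u,v)]$. Extend $\varphi$ to the co-Poisson bracket $\varphi:\mathrm U(\mathfrak g)\to\mathrm U(\mathfrak g)^{\otimes2}$, i.e. $\varphi(XY)=\varphi(X)\Delta(Y)+\Delta(X)\varphi(Y)$ with $\Delta$ the standard comultiplication of $\mathrm U(\mathfrak g)$. Let $h$ be a formal parameter of $\mathbb Z_2$-degree zero. $\mathrm Y(\mathfrak q_N,h)$ is the unital $\mathbb C[[h]]$-subalgebra of $\mathbb C[[h]]\otimes\mathrm Y(\mathfrak q_N)$ generated by the elements $H^{(s)}_{ij}=T^{(s)}_{ij}h^{s-1}$, $s\ge1$.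 The comultiplication $\Delta$ is extended to it by $\mathbb C[[h]]$-linearity (tensor product over $\mathbb C[[h]]$), and $\Delta^{\circ}=\theta\circ\Delta$. There is an isomorphism of Hopf superalgebras $\mathrm Y(\mathfrak q_N,h)/h\mathrm Y(\mathfrak q_N,h)\to\mathrm U(\mathfrak g)$ given by $H^{(s)}_{ij}+h\mathrm Y(\mathfrak q_N,h)\mapsto -F^{(s-1)}_{ji}(-1)^{\bar\jmath}$; $\psi:\mathrm Y(\mathfrak q_N,h)\to\mathrm U(\mathfrak g)$ is the composition of the quotient map with this isomorphism. *)

(* Defs.v *)
From HB Require Import structures.
From mathcomp Require Import all_boot all_order all_algebra.
From mathcomp Require Import boolp.
From mathcomp Require Import finmap monalg.

Set Implicit Arguments.
Unset Strict Implicit.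
Unset Printing Implicit Defensive.

Import GRing.Theory.
Local Open Scope ring_scope.
Local Open Scope quotient_scope.

(** [hpart p x] is the component of degree [p] of [x]: [false] is the even
    degree 0 and [true] the odd degree 1. *)
HB.mixin Record Lmodule_isSuper (R : comNzRingType) V of GRing.Lmodule R V := {
  hpart : bool -> V -> V;
  hpart_is_linear_ax : forall p, linear (hpart p);
  hpart_sum_ax : forall x, hpart false x + hpart true x = x;
  hpart_hpart_ax : forall p q x, hpart p (hpart q x) = if p == q then hpart q x else 0
}.
#[short(type="superModType")]
HB.structure Definition SuperModule (R : comNzRingType) :=
  {V of GRing.Lmodule R V & Lmodule_isSuper R V}.

(** MathComp's [algType] requires [1 != 0].  This is not imposed here, so that
    algebras given by generators and relations are covered; hence the separate
    product [x *s y] and unit [sone]. *)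
HB.mixin Record SuperModule_isSuperAlgebra (R : comNzRingType) A
    of SuperModule R A := {
  sone : A;
  smul : A -> A -> A;
  smulA_ax : associative smul;
  smul1x_ax : left_id sone smul;
  smulx1_ax : right_id sone smul;
  smul_is_linear_l_ax : forall y, linear (smul^~ y);
  smul_is_linear_r_ax : forall x, linear (smul x);
  hpartM_ax : forall p q x y,
    hpart (p (+) q) (smul (hpart p x) (hpart q y)) = smul (hpart p x) (hpart q y)
}.
#[short(type="superAlgType")]
HB.structure Definition SuperAlgebra (R : comNzRingType) :=
  {A of SuperModule R A & SuperModule_isSuperAlgebra R A}.

Arguments sone {R s}.
Notation "x *s y" := (smul x y) (at level 40, left associativity) : ring_scope.

Definition homog (R : comNzRingType) (V : superModType R) p (x : V) : Prop :=
  hpart p x = x.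

Section SuperModuleTheory.
Context (R : comNzRingType) (V : superModType R).

Lemma hpart_is_linear p : linear (@hpart R V p).
Proof. exact: hpart_is_linear_ax. Qed.
Lemma hpart_sum (x : V) : hpart false x + hpart true x = x.
Proof. exact: hpart_sum_ax. Qed.
Lemma hpart_hpart p q (x : V) :
  hpart p (hpart q x) = if p == q then hpart q x else 0.
Proof. exact: hpart_hpart_ax. Qed.

HB.instance Definition _ p :=
  GRing.isLinear.Build R V V _ (@hpart R V p) (hpart_is_linear p).

Lemma hpart_homog p (x : V) : homog p (hpart p x).
Proof. by rewrite /homog hpart_hpart eqxx. Qed.

Lemma homog_hpart p q (x : V) : homog p x -> hpart q x = if q == p then x else 0.
Proof. by move=> hx; rewrite -{1}hx hpart_hpart hx. Qed.

Lemma homogD p (x y : V) : homog p x -> homog p y -> homog p (x + y).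
Proof. by rewrite /homog linearD /= => -> ->. Qed.

Lemma homogZ p a (x : V) : homog p x -> homog p (a *: x).
Proof. by rewrite /homog linearZ /= => ->. Qed.

Lemma hpart_bigsum (x : V) : \sum_(p : bool) hpart p x = x.
Proof. by rewrite big_bool /= addrC hpart_sum. Qed.

End SuperModuleTheory.

Section SuperAlgebraTheory.
Context (R : comNzRingType) (A : superAlgType R).

Lemma smulA : associative (@smul R A).
Proof. exact: smulA_ax. Qed.
Lemma smul1x : left_id sone (@smul R A).
Proof. exact: smul1x_ax. Qed.
Lemma smulx1 : right_id sone (@smul R A).
Proof. exact: smulx1_ax. Qed.
Lemma smul_is_linear_l (y : A) : linear (fun x => x *s y).
Proof. exact: smul_is_linear_l_ax. Qed.
Lemma smul_is_linear_r (x : A) : linear (smul x).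
Proof. exact: smul_is_linear_r_ax. Qed.
Lemma hpartM p q (x y : A) :
  hpart (p (+) q) (hpart p x *s hpart q y) = hpart p x *s hpart q y.
Proof. exact: hpartM_ax. Qed.

HB.instance Definition _ x :=
  GRing.isLinear.Build R A A _ (@smul R A x) (smul_is_linear_r x).

Lemma smulDl (x y z : A) : (x + y) *s z = x *s z + y *s z.
Proof. by have := smul_is_linear_l z 1 x y; rewrite !scale1r. Qed.
Lemma smulDr (x y z : A) : x *s (y + z) = x *s y + x *s z.
Proof. exact: linearD. Qed.
Lemma smul0x (x : A) : 0 *s x = 0.
Proof. by apply: (@addrI _ (0 *s x)); rewrite -smulDl !addr0. Qed.
Lemma smulx0 (x : A) : x *s 0 = 0.
Proof. exact: linear0. Qed.
Lemma smulZl a (x y : A) : (a *: x) *s y = a *: (x *s y).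
Proof. by have := smul_is_linear_l y a x 0; rewrite !addr0 smul0x addr0. Qed.
Lemma smulZr a (x y : A) : x *s (a *: y) = a *: (x *s y).
Proof. exact: linearZ. Qed.
Lemma smulNl (x y : A) : (- x) *s y = - (x *s y).
Proof. by rewrite -scaleN1r smulZl scaleN1r. Qed.
Lemma smulNr (x y : A) : x *s (- y) = - (x *s y).
Proof. exact: linearN. Qed.
Lemma smul_suml I r (P : pred I) (F : I -> A) (y : A) :
  (\sum_(i <- r | P i) F i) *s y = \sum_(i <- r | P i) F i *s y.
Proof. exact: (big_morph (smul^~ y) (fun a b => smulDl a b y) (smul0x y)). Qed.
Lemma smul_sumr I r (P : pred I) (F : I -> A) (x : A) :
  x *s (\sum_(i <- r | P i) F i) = \sum_(i <- r | P i) x *s F i.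
Proof. exact: linear_sum. Qed.

Lemma homogM p q (x y : A) : homog p x -> homog q y -> homog (p (+) q) (x *s y).
Proof. by rewrite /homog => <- <-; rewrite hpartM. Qed.

Lemma homog1 : homog false (sone : A).
Proof.
set e0 := hpart false (sone : A); set e1 := hpart true (sone : A).
have h0 : homog false e0 by apply: hpart_homog.
have h1 : homog true e1 by apply: hpart_homog.
have e10 : e1 *s e1 = 0.
  have : hpart false (e1 *s (e0 + e1)) = 0.
    by rewrite /e0 /e1 hpart_sum smulx1 hpart_hpart.
  rewrite smulDr linearD /= (homog_hpart _ (homogM h1 h0)).
  by rewrite (homog_hpart _ (homogM h1 h1)) /= add0r.
have e1E : e1 *s e0 = e1.
  by rewrite -[RHS]smulx1 -(hpart_sum sone) smulDr -/e0 -/e1 e10 addr0.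
have : hpart true ((e0 + e1) *s e0) = 0.
  by rewrite /e0 /e1 hpart_sum smul1x hpart_hpart.
rewrite smulDl linearD /= (homog_hpart _ (homogM h1 h0)).
rewrite (homog_hpart _ (homogM h0 h0)) /= add0r e1E => e1_0.
by rewrite /homog -[RHS](hpart_sum sone) -/e0 -/e1 e1_0 addr0.
Qed.

End SuperAlgebraTheory.

(** The supercommutator, extended bilinearly from homogeneous elements. *)
Definition sbracket (R : comNzRingType) (A : superAlgType R) (x y : A) : A :=
  \sum_(p : bool) \sum_(q : bool)
    (hpart p x *s hpart q y - (-1) ^+ (p && q) *: (hpart q y *s hpart p x)).

(** [f] is a homomorphism of superalgebras, semilinear along [sg : R -> R']. *)
Record is_superalg_hom (R R' : comNzRingType) (sg : R -> R')
    (A : superAlgType R) (B : superAlgType R') (f : A -> B) : Prop := {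
  shom_add : forall x y, f (x + y) = f x + f y;
  shom_scale : forall a x, f (a *: x) = sg a *: f x;
  shom_one : f sone = sone;
  shom_mul : forall x y, f (x *s y) = f x *s f y;
  shom_hpart : forall p x, f (hpart p x) = hpart p (f x)
}.

Section Tensor.
Context (R : comNzRingType) (M N : lmodType R).

(** [tens M N] is the type of formal sums of pairs, written as sequences,
    modulo the congruence generated by bilinearity. *)
Inductive tens_eqv : seq (M * N) -> seq (M * N) -> Prop :=
| tens_refl s : tens_eqv s s
| tens_sym s t : tens_eqv s t -> tens_eqv t s
| tens_trans s t u : tens_eqv s t -> tens_eqv t u -> tens_eqv s u
| tens_cat s s' t t' : tens_eqv s s' -> tens_eqv t t' -> tens_eqv (s ++ t) (s' ++ t')
| tens_catC s t : tens_eqv (s ++ t) (t ++ s)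
| tens_0 n : tens_eqv [:: (0, n)] [::]
| tens_Dl m m' n : tens_eqv [:: (m + m', n)] [:: (m, n); (m', n)]
| tens_Dr m n n' : tens_eqv [:: (m, n + n')] [:: (m, n); (m, n')]
| tens_Z a m n : tens_eqv [:: (a *: m, n)] [:: (m, a *: n)].

Definition tens_rel s t := `[< tens_eqv s t >].

Lemma tens_rel_equiv : equiv_class_of tens_rel.
Proof.
split=> [s|s t|t s u].
- exact/asboolP/tens_refl.
- by apply/asboolP/asboolP; apply: tens_sym.
- by move=> /asboolP h /asboolP h'; apply/asboolP; apply: tens_trans h h'.
Qed.
Canonical tens_equiv := EquivRelPack tens_rel_equiv.

Definition tens : Type := {eq_quot tens_equiv}.
HB.instance Definition _ := Choice.on tens.
HB.instance Definition _ := EqQuotient.on tens.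

Lemma tens_piP s t : tens_eqv s t -> \pi_tens s = \pi_tens t.
Proof. by move=> h; apply/eqmodP/asboolP. Qed.

Lemma tens_reprP s : tens_eqv (repr (\pi_tens s)) s.
Proof. by have /eqmodP/asboolP : \pi_tens (repr (\pi_tens s)) = \pi_tens s by rewrite reprK. Qed.

Definition pure (m : M) (n : N) : tens := \pi_tens [:: (m, n)].

Definition tzero : tens := \pi_tens [::].
Definition tadd (x y : tens) : tens := \pi_tens (repr x ++ repr y).
Definition tscale (a : R) (x : tens) : tens :=
  \pi_tens [seq (a *: t.1, t.2) | t <- repr x].
Definition topp (x : tens) : tens := tscale (-1) x.

Lemma tens_scale_eqv a s t : tens_eqv s t ->
  tens_eqv [seq (a *: t.1, t.2) | t <- s] [seq (a *: t.1, t.2) | t <- t].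
Proof.
elim=> {s t} /= [s|s t _|s t u _ h _|s s' t t' _ h _ h'|s t|n|m m' n|m n n'|b m n].
- exact: tens_refl.
- exact: tens_sym.
- exact: tens_trans h.
- by rewrite !map_cat; apply: tens_cat.
- by rewrite !map_cat; apply: tens_catC.
- by rewrite scaler0; apply: tens_0.
- by rewrite scalerDr; apply: tens_Dl.
- exact: tens_Dr.
- by rewrite scalerA mulrC -scalerA; apply: tens_Z.
Qed.

Lemma tadd_pi s t : tadd (\pi s) (\pi t) = \pi_tens (s ++ t).
Proof. by apply: tens_piP; apply: tens_cat; apply: tens_reprP. Qed.

Lemma tscale_pi a s : tscale a (\pi s) = \pi_tens [seq (a *: t.1, t.2) | t <- s].
Proof. by apply: tens_piP; apply: tens_scale_eqv; apply: tens_reprP. Qed.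

Lemma taddA : associative tadd.
Proof.
by elim/quotW=> x; elim/quotW=> y; elim/quotW=> z; rewrite !tadd_pi catA.
Qed.

Lemma taddC : commutative tadd.
Proof.
by elim/quotW=> x; elim/quotW=> y; rewrite !tadd_pi; apply/tens_piP/tens_catC.
Qed.

Lemma tadd0 : left_id tzero tadd.
Proof. by elim/quotW=> x; rewrite tadd_pi. Qed.

Lemma tscaleDl_pi a b s :
  tadd (\pi [seq (a *: t.1, t.2) | t <- s]) (\pi [seq (b *: t.1, t.2) | t <- s])
  = \pi_tens [seq ((a + b) *: t.1, t.2) | t <- s].
Proof.
elim: s => [|[m n] s ihs]; first by rewrite tadd_pi.
have E c t : \pi_tens ((c *: m, n) :: t) = tadd (pure (c *: m) n) (\pi t).
  by rewrite tadd_pi.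
rewrite /= !E -ihs.
rewrite -!taddA [tadd (\pi _) (tadd (pure (b *: m) n) _)]taddA.
rewrite [tadd (\pi _) (pure (b *: m) n)]taddC -taddA taddA; congr tadd.
by rewrite tadd_pi scalerDl; apply/esym/tens_piP/tens_Dl.
Qed.

Lemma tens_zeros s : \pi_tens [seq (0 *: t.1, t.2) | t <- s] = tzero.
Proof.
elim: s => [//|[m n] s ihs].
have -> : \pi_tens [seq (0 *: t.1, t.2) | t <- (m, n) :: s]
        = tadd (pure 0 n) (\pi [seq (0 *: t.1, t.2) | t <- s]).
  by rewrite tadd_pi /= scale0r.
rewrite ihs taddC tadd0; apply: tens_piP; exact: tens_0.
Qed.

Lemma taddN : left_inverse tzero topp tadd.
Proof.
elim/quotW=> s; rewrite /topp tscale_pi.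
have {2}-> : s = [seq (1 *: t.1, t.2) | t <- s].
  by elim: s => //= [[m n] s <-]; rewrite scale1r.
by rewrite tscaleDl_pi addNr tens_zeros.
Qed.

HB.instance Definition _ := GRing.isZmodule.Build tens taddA taddC tadd0 taddN.

Lemma tens_piD s t : \pi_tens (s ++ t) = \pi_tens s + \pi_tens t.
Proof. by rewrite -tadd_pi. Qed.

Lemma tscaleA a b x : tscale a (tscale b x) = tscale (a * b) x.
Proof.
elim/quotW: x => s; rewrite !tscale_pi -map_comp; congr (\pi _).
by apply: eq_map => t /=; rewrite scalerA.
Qed.

Lemma tscale1 : left_id 1 tscale.
Proof.
elim/quotW=> s; rewrite tscale_pi; congr (\pi _).
by elim: s => //= [[m n] s ->]; rewrite scale1r.
Qed.

Lemma tscaleDr : right_distributive tscale +%R.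
Proof.
by move=> a; elim/quotW=> s; elim/quotW=> t; rewrite -tens_piD !tscale_pi map_cat tens_piD.
Qed.

Lemma tscaleDl x : {morph tscale^~ x : a b / a + b}.
Proof. by move=> a b; elim/quotW: x => s; rewrite !tscale_pi -tscaleDl_pi. Qed.

HB.instance Definition _ :=
  GRing.Zmodule_isLmodule.Build R tens tscaleA tscale1 tscaleDr tscaleDl.

Lemma pureDl m m' n : pure (m + m') n = pure m n + pure m' n.
Proof. by rewrite -tens_piD; apply/tens_piP/tens_Dl. Qed.
Lemma pureDr m n n' : pure m (n + n') = pure m n + pure m n'.
Proof. by rewrite -tens_piD; apply/tens_piP/tens_Dr. Qed.
Lemma pureZl a m n : pure (a *: m) n = a *: pure m n.
Proof. by apply/esym; apply: tscale_pi. Qed.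
Lemma pureZr a m n : pure m (a *: n) = a *: pure m n.
Proof. by rewrite -pureZl; apply/esym/tens_piP/tens_Z. Qed.

Lemma tens_pi_sum s : \pi_tens s = \sum_(t <- s) pure t.1 t.2.
Proof.
elim: s => [|[m n] s ihs]; first by rewrite big_nil.
by rewrite big_cons -ihs -tens_piD.
Qed.

Lemma tensE (x : tens) : x = \sum_(t <- repr x) pure t.1 t.2.
Proof. by rewrite -tens_pi_sum reprK. Qed.

Lemma tens_ind (P : tens -> Prop) :
  P 0 -> (forall x y, P x -> P y -> P (x + y)) -> (forall m n, P (pure m n)) ->
  forall x, P x.
Proof.
move=> P0 PD Pp x; rewrite (tensE x); apply: big_ind => //= t _; exact: Pp.
Qed.

End Tensor.

Reserved Notation "M ⊗[ R ] N" (at level 40, left associativity,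
  format "M  ⊗[ R ]  N").
Notation "M ⊗[ R ] N" := (@tens R M N) : type_scope.
Notation "x ⊗ y" := (pure x y) (at level 40, left associativity) : ring_scope.

(** [tens_lift f] sends [x ⊗ y] to [f x y] whenever [f] is balanced; it is
    meaningless otherwise. *)
Definition tens_lift (R : comNzRingType) (M N : lmodType R) (P : zmodType)
    (f : M -> N -> P) (x : M ⊗[R] N) : P :=
  \sum_(t <- repr x) f t.1 t.2.

Definition balanced (R : comNzRingType) (M N : lmodType R) (P : zmodType)
    (f : M -> N -> P) : Prop :=
  [/\ forall m m' n, f (m + m') n = f m n + f m' n,
      forall m n n', f m (n + n') = f m n + f m n'
    & forall a m n, f (a *: m) n = f m (a *: n)].

Section TensorLift.
Context (R : comNzRingType) (M N : lmodType R).

Lemma tens_lift_pi (P : zmodType) (f : M -> N -> P) s : balanced f ->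
  tens_lift f (\pi s) = \sum_(t <- s) f t.1 t.2.
Proof.
case=> fDl fDr fZ; rewrite /tens_lift.
suff E s1 s2 : tens_eqv s1 s2 ->
    \sum_(t <- s1) f t.1 t.2 = \sum_(t <- s2) f t.1 t.2.
  exact/E/tens_reprP.
elim=> {s s1 s2}
  [//|s t _ ->//|s t u _ -> _ ->//|s s' t t' _ h _ h'|s t|n|m m' n|m n n'|a m n].
- by rewrite !big_cat /= h h'.
- by rewrite !big_cat /= addrC.
- rewrite big_seq1 big_nil /=; apply/eqP.
  by rewrite -(inj_eq (addrI (f 0 n))) -fDl !addr0.
- by rewrite !big_cons !big_nil /= !addr0 fDl.
- by rewrite !big_cons !big_nil /= !addr0 fDr.
- by rewrite !big_seq1 /= fZ.
Qed.

Lemma tens_lift_pure (P : zmodType) (f : M -> N -> P) m n : balanced f ->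
  tens_lift f (m ⊗ n) = f m n.
Proof. by move=> bf; rewrite tens_lift_pi // big_seq1. Qed.

Lemma tens_liftD (P : zmodType) (f : M -> N -> P) : balanced f ->
  {morph tens_lift f : x y / x + y}.
Proof.
move=> bf; elim/quotW=> s; elim/quotW=> t.
by rewrite -tens_piD !tens_lift_pi // big_cat.
Qed.

Lemma tens_liftZ (R' : comNzRingType) (sg : R -> R') (P : lmodType R')
    (f : M -> N -> P) : balanced f ->
  (forall a m n, f (a *: m) n = sg a *: f m n) ->
  forall a x, tens_lift f (a *: x) = sg a *: tens_lift f x.
Proof.
move=> bf fZ a; elim/quotW=> s.
have -> : a *: \pi_(M ⊗[R] N) s = \pi [seq (a *: t.1, t.2) | t <- s].
  by rewrite -tscale_pi.
rewrite !tens_lift_pi // big_map scaler_sumr.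
by apply: eq_bigr => t _ /=; rewrite fZ.
Qed.

Lemma tens_lift_linear (P : lmodType R) (f : M -> N -> P) : balanced f ->
  (forall a m n, f (a *: m) n = a *: f m n) -> linear (tens_lift f).
Proof.
by move=> bf fZ a x y; rewrite tens_liftD // (tens_liftZ (sg := id)).
Qed.

End TensorLift.

Section TensorSuper.
Context (R : comNzRingType) (M N : superModType R).
Implicit Types (m : M) (n : N).

Lemma pure0l n : (0 : M) ⊗ n = 0.
Proof. by rewrite -(scale0r (0 : M)) pureZl scale0r. Qed.
Lemma pure0r m : m ⊗ (0 : N) = 0.
Proof. by rewrite -(scale0r (0 : N)) pureZr scale0r. Qed.

Lemma tens_hind (P : M ⊗[R] N -> Prop) :
  P 0 -> (forall x y, P x -> P y -> P (x + y)) ->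
  (forall a b m n, homog a m -> homog b n -> P (m ⊗ n)) -> forall x, P x.
Proof.
move=> P0 PD Pp; apply: tens_ind => // m n.
rewrite -(hpart_sum m) -(hpart_sum n) pureDl !pureDr.
by apply: (PD); apply: (PD); apply: Pp (hpart_homog _ _) (hpart_homog _ _).
Qed.

Definition tens_hpart_fun p m n : M ⊗[R] N :=
  \sum_(q : bool) hpart q m ⊗ hpart (p (+) q) n.

Definition tens_hpart p : M ⊗[R] N -> M ⊗[R] N := tens_lift (tens_hpart_fun p).

Lemma tens_hpart_bal p : balanced (tens_hpart_fun p).
Proof.
split=> [m m' n|m n n'|a m n]; rewrite /tens_hpart_fun -?big_split;
  apply: eq_bigr => q _ /=.
- by rewrite linearD pureDl.
- by rewrite linearD pureDr.
- by rewrite !linearZ /= pureZl pureZr.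
Qed.

Lemma tens_hpart_is_linear p : linear (tens_hpart p).
Proof.
apply: tens_lift_linear (tens_hpart_bal p) _ => a m n.
rewrite /tens_hpart_fun scaler_sumr; apply: eq_bigr => q _.
by rewrite linearZ /= pureZl.
Qed.

Lemma tens_hpartD p x y : tens_hpart p (x + y) = tens_hpart p x + tens_hpart p y.
Proof. exact: tens_liftD (tens_hpart_bal p) x y. Qed.

Lemma tens_hpart0 p : tens_hpart p 0 = 0.
Proof. by apply: (@addrI _ (tens_hpart p 0)); rewrite -tens_hpartD !addr0. Qed.

Lemma tens_hpart_pure p a b m n : homog a m -> homog b n ->
  tens_hpart p (m ⊗ n) = if p == a (+) b then m ⊗ n else 0.
Proof.
move=> hm hn; rewrite /tens_hpart tens_lift_pure; last exact: tens_hpart_bal.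
rewrite /tens_hpart_fun big_bool /= !(homog_hpart _ hm) !(homog_hpart _ hn).
by case: a {hm}; case: b {hn}; case: p => /=;
  rewrite ?pure0l ?pure0r ?addr0 ?add0r.
Qed.

Lemma tens_hpart_sum x : tens_hpart false x + tens_hpart true x = x.
Proof.
elim/tens_hind: x => [|x y hx hy|a b m n hm hn].
- by rewrite !tens_hpart0 addr0.
- by rewrite !tens_hpartD addrACA hx hy.
- rewrite !(tens_hpart_pure _ hm hn).
  by case: (a (+) b); rewrite /= ?addr0 ?add0r.
Qed.

Lemma tens_hpart_hpart p q x :
  tens_hpart p (tens_hpart q x) = if p == q then tens_hpart q x else 0.
Proof.
elim/tens_hind: x => [|x y hx hy|a b m n hm hn].
- by rewrite !tens_hpart0 if_same.
- by rewrite !tens_hpartD hx hy; case: eqP; rewrite ?addr0.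
- rewrite !(tens_hpart_pure _ hm hn).
  case: eqP => [->|_]; last by rewrite tens_hpart0 if_same.
  by rewrite (tens_hpart_pure _ hm hn).
Qed.

HB.instance Definition _ := Lmodule_isSuper.Build R (M ⊗[R] N)
  tens_hpart_is_linear tens_hpart_sum tens_hpart_hpart.

Lemma hpart_pure p a b m n : homog a m -> homog b n ->
  hpart p (m ⊗ n) = if p == a (+) b then m ⊗ n else 0.
Proof. exact: tens_hpart_pure. Qed.

End TensorSuper.

Section TensorAlgebra.
Context (R : comNzRingType) (A B : superAlgType R).
Implicit Types (a : A) (b : B) (x y z : A ⊗[R] B).

Definition tens_mul_fun a b a' b' : A ⊗[R] B :=
  \sum_(d : bool) \sum_(e : bool)
    (-1) ^+ (d && e) *: ((a *s hpart d a') ⊗ (hpart e b *s b')).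

Definition tens_mul x y : A ⊗[R] B :=
  tens_lift (fun a b => tens_lift (tens_mul_fun a b) y) x.

Definition tens_one : A ⊗[R] B := sone ⊗ sone.

Lemma tens_mul_fun_bal a b : balanced (tens_mul_fun a b).
Proof.
split=> [m m' n|m n n'|k m n]; rewrite /tens_mul_fun -?big_split;
  apply: eq_bigr => d _ /=; rewrite -?big_split; apply: eq_bigr => e _ /=.
- by rewrite linearD smulDr pureDl scalerDr.
- by rewrite smulDr pureDr scalerDr.
- by rewrite linearZ /= !smulZr pureZl pureZr.
Qed.

Lemma tens_mul_out_bal y : balanced (fun a b => tens_lift (tens_mul_fun a b) y).
Proof.
split=> [m m' n|m n n'|k m n]; rewrite /tens_lift -?big_split;
  apply: eq_bigr => t _ /=; rewrite /tens_mul_fun -?big_split;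
  apply: eq_bigr => d _ /=; rewrite -?big_split; apply: eq_bigr => e _ /=.
- by rewrite smulDl pureDl scalerDr.
- by rewrite linearD smulDl pureDr scalerDr.
- by rewrite linearZ /= !smulZl pureZl pureZr.
Qed.

Lemma tens_mul_linear_l y : linear (tens_mul^~ y).
Proof.
apply: tens_lift_linear (tens_mul_out_bal y) _ => k a b.
rewrite /tens_lift scaler_sumr; apply: eq_bigr => t _.
rewrite /tens_mul_fun scaler_sumr; apply: eq_bigr => d _.
rewrite scaler_sumr; apply: eq_bigr => e _.
by rewrite smulZl pureZl !scalerA mulrC.
Qed.

Lemma tens_mul_linear_r x : linear (tens_mul x).
Proof.
move=> k y z; rewrite /tens_mul {1 3 5}/tens_lift scaler_sumr -big_split /=.
apply: eq_bigr => t _.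
apply: (tens_lift_linear (tens_mul_fun_bal t.1 t.2)) => {y z} {}k a b.
rewrite /tens_mul_fun scaler_sumr; apply: eq_bigr => d _.
rewrite scaler_sumr; apply: eq_bigr => e _.
by rewrite linearZ /= smulZr pureZl !scalerA mulrC.
Qed.

Lemma tens_mulDl x y z : tens_mul (x + y) z = tens_mul x z + tens_mul y z.
Proof. by have := tens_mul_linear_l z 1 x y; rewrite !scale1r. Qed.
Lemma tens_mulDr x y z : tens_mul x (y + z) = tens_mul x y + tens_mul x z.
Proof. by have := tens_mul_linear_r x 1 y z; rewrite !scale1r. Qed.
Lemma tens_mul0l y : tens_mul 0 y = 0.
Proof. by apply: (@addrI _ (tens_mul 0 y)); rewrite -tens_mulDl !addr0. Qed.
Lemma tens_mul0r y : tens_mul y 0 = 0.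
Proof. by apply: (@addrI _ (tens_mul y 0)); rewrite -tens_mulDr !addr0. Qed.
Lemma tens_mulZl k x y : tens_mul (k *: x) y = k *: tens_mul x y.
Proof. by have := tens_mul_linear_l y k x 0; rewrite tens_mul0l !addr0. Qed.
Lemma tens_mulZr k x y : tens_mul x (k *: y) = k *: tens_mul x y.
Proof. by have := tens_mul_linear_r x k y 0; rewrite tens_mul0r !addr0. Qed.

Lemma tens_mul_pure d e a b a' b' : homog e b -> homog d a' ->
  tens_mul (a ⊗ b) (a' ⊗ b') = (-1) ^+ (d && e) *: ((a *s a') ⊗ (b *s b')).
Proof.
move=> hb ha'; rewrite /tens_mul tens_lift_pure; last exact: tens_mul_out_bal.
rewrite tens_lift_pure; last exact: tens_mul_fun_bal.
rewrite /tens_mul_fun (bigD1 d) //= (bigD1 e) //=.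
rewrite hb ha' big1 ?addr0 => [|e' /negbTE ne]; last first.
  by rewrite (homog_hpart _ hb) ne smul0x pure0r scaler0.
rewrite big1 ?addr0 // => d' /negbTE nd; apply: big1 => e' _.
by rewrite (homog_hpart _ ha') nd smulx0 pure0l scaler0.
Qed.

Lemma tens_mulA : associative tens_mul.
Proof.
move=> x y z; elim/tens_hind: x => [|x x' h h'|p q a b ha hb].
- by rewrite !tens_mul0l.
- by rewrite !tens_mulDl h h'.
elim/tens_hind: y => [|x x' h h'|p' q' a' b' ha' hb'].
- by rewrite !(tens_mul0l, tens_mul0r).
- by rewrite !(tens_mulDl, tens_mulDr) h h'.
elim/tens_hind: z => [|x x' h h'|p'' q'' a'' b'' ha'' hb''].
- by rewrite !tens_mul0r.
- by rewrite !tens_mulDr h h'.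
rewrite (tens_mul_pure _ _ hb' ha'') (tens_mul_pure _ _ hb ha') tens_mulZl tens_mulZr.
rewrite (tens_mul_pure _ _ hb (homogM ha' ha'')) (tens_mul_pure _ _ (homogM hb hb') ha'').
rewrite !smulA !scalerA -!signr_addb; congr (_ *: _).
by case: p' {ha'}; case: p'' {ha''}; case: q {hb}; case: q' {hb'}.
Qed.

Lemma tens_mul1x : left_id tens_one tens_mul.
Proof.
move=> x; elim/tens_hind: x => [|x x' h h'|p q a b ha hb].
- by rewrite tens_mul0r.
- by rewrite tens_mulDr h h'.
by rewrite (tens_mul_pure _ _ (homog1 _) ha) andbF scale1r !smul1x.
Qed.

Lemma tens_mulx1 : right_id tens_one tens_mul.
Proof.
move=> x; elim/tens_hind: x => [|x x' h h'|p q a b ha hb].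
- by rewrite tens_mul0l.
- by rewrite tens_mulDl h h'.
by rewrite (tens_mul_pure _ _ hb (homog1 _)) scale1r !smulx1.
Qed.

Lemma tens_hpartM p q x y :
  hpart (p (+) q) (tens_mul (hpart p x) (hpart q y)) = tens_mul (hpart p x) (hpart q y).
Proof.
elim/tens_hind: x => [|x x' h h'|c d a b ha hb].
- by rewrite linear0 tens_mul0l linear0.
- by rewrite [hpart p (x + x')]linearD tens_mulDl linearD /= h h'.
elim/tens_hind: y => [|x x' h h'|c' d' a' b' ha' hb'].
- by rewrite linear0 tens_mul0r linear0.
- by rewrite [hpart q (x + x')]linearD tens_mulDr linearD /= h h'.
rewrite !(hpart_pure _ ha hb) !(hpart_pure _ ha' hb').
case: eqP => [->|_]; last by rewrite tens_mul0l linear0.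
case: eqP => [->|_]; last by rewrite tens_mul0r linear0.
rewrite (tens_mul_pure _ _ hb ha') linearZ /=.
rewrite (hpart_pure _ (homogM ha ha') (homogM hb hb')).
by rewrite addbACA eqxx.
Qed.

HB.instance Definition _ := SuperModule_isSuperAlgebra.Build R (A ⊗[R] B)
  tens_mulA tens_mul1x tens_mulx1 tens_mul_linear_l tens_mul_linear_r tens_hpartM.

End TensorAlgebra.

(** [f ⊗ g], for [f] and [g] semilinear along a common map [R -> R']. *)
Definition tens_map (R R' : comNzRingType) (M N : lmodType R) (M' N' : lmodType R')
    (f : M -> M') (g : N -> N') : M ⊗[R] N -> M' ⊗[R'] N' :=
  tens_lift (fun m n => f m ⊗ g n).

(** The flip [x ⊗ y |-> (-1)^(deg x deg y) y ⊗ x]. *)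
Definition tens_flip (R : comNzRingType) (M N : superModType R) :
    M ⊗[R] N -> N ⊗[R] M :=
  tens_lift (fun m n => \sum_(p : bool) \sum_(q : bool)
    (-1) ^+ (p && q) *: (hpart q n ⊗ hpart p m)).

Section MalgLinear.
Context (K : comNzRingType) (M : monomType).
Implicit Types x y z : {malg K[M]}.

Lemma malg_mul_linear_l y : linear (fun x => x * y).
Proof. by move=> a x z; rewrite mulrDl -scalerAl. Qed.

Lemma malg_mul_linear_r x : linear (fun y => x * y).
Proof.
move=> a y z; rewrite mulrDr; congr (_ + _); apply/malgP => w.
rewrite mcoeffZ (mcoeffMlw _ (fsubset_refl _) (msuppZ_le a y)) mcoeffMl.
rewrite big_distrr; apply: eq_bigr => u _; rewrite big_distrr /=.
apply: eq_bigr => v _; rewrite mcoeffZ mulrnAr; congr (_ *+ _).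
by rewrite mulrCA.
Qed.

Definition malg_filter (P : pred M) x : {malg K[M]} :=
  \sum_(w <- msupp x | P w) mkmalgU w (mcoeff w x).

Lemma malg_filterE P x w :
  mcoeff w (malg_filter P x) = if P w then mcoeff w x else 0.
Proof.
rewrite /malg_filter raddf_sum /= big_mkcond /=.
have E v : (if P v then mcoeff w (mkmalgU v (mcoeff v x)) else 0)
    = if P w then mcoeff w (mkmalgU v (mcoeff v x)) else 0.
  by rewrite mcoeffU; case: (eqVneq v w) => [->//|_]; rewrite mulr0n !if_same.
rewrite (eq_bigr _ (fun v _ => E v)); case: (P w); last by rewrite big1.
by rewrite [in RHS](monalgE x) raddf_sum.
Qed.

Lemma malg_filter_is_linear P : linear (malg_filter P).
Proof.
move=> a x y; apply/malgP => w; rewrite mcoeffD mcoeffZ !malg_filterE.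
by rewrite mcoeffD mcoeffZ; case: (P w); rewrite ?mulr0 ?addr0.
Qed.
End MalgLinear.

(** The parities [deg] of the generators determine the grading only. *)
Definition free_salg (K : comNzRingType) (G : choiceType) (deg : G -> bool) : Type :=
  {malg K[{fmonom G}]}.

Section Free.
Context (K : comNzRingType) (G : choiceType) (deg : G -> bool).
Local Notation F := (@free_salg K G deg).
Implicit Types x y : F.

HB.instance Definition _ := GRing.Lmodule.copy F {malg K[{fmonom G}]}.

Definition gen (g : G) : F := mkmalgU (fmu g) 1.

Definition word_deg (w : {fmonom G}) : bool :=
  \big[addb/false]_(g <- (w : seq G)) deg g.

Definition free_hpart p x : F := malg_filter (fun w => word_deg w == p) x.

Lemma free_hpartE p x w :
  mcoeff w (free_hpart p x) = if word_deg w == p then mcoeff w x else 0.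
Proof. exact: malg_filterE. Qed.

Lemma free_hpart_is_linear p : linear (free_hpart p).
Proof. exact: malg_filter_is_linear. Qed.

Lemma free_hpart_sum x : free_hpart false x + free_hpart true x = x.
Proof.
apply/malgP => w; rewrite mcoeffD !free_hpartE.
by case: (word_deg w); rewrite /= ?addr0 ?add0r.
Qed.

Lemma free_hpart_hpart p q x :
  free_hpart p (free_hpart q x) = if p == q then free_hpart q x else 0.
Proof.
apply/malgP => w; rewrite free_hpartE !(fun_if (mcoeff w)) mcoeff0 free_hpartE.
by case: (word_deg w); case: p; case: q.
Qed.

HB.instance Definition _ := Lmodule_isSuper.Build K F
  free_hpart_is_linear free_hpart_sum free_hpart_hpart.

Definition free_one : F := (1 : {malg K[{fmonom G}]}).
Definition free_mul x y : F := ((x : {malg K[{fmonom G}]}) * y)%R.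

Lemma free_mulA : associative free_mul.
Proof. exact: mulrA. Qed.
Lemma free_mul1x : left_id free_one free_mul.
Proof. exact: mul1r. Qed.
Lemma free_mulx1 : right_id free_one free_mul.
Proof. exact: mulr1. Qed.

Lemma free_mul_linear_l y : linear (free_mul^~ y).
Proof. exact: malg_mul_linear_l. Qed.
Lemma free_mul_linear_r x : linear (free_mul x).
Proof. exact: malg_mul_linear_r. Qed.

Lemma word_degM u v : word_deg (mmul u v) = word_deg u (+) word_deg v.
Proof. by rewrite /word_deg fmM big_cat. Qed.

Lemma free_hpartM p q x y :
  hpart (p (+) q) (free_mul (hpart p x) (hpart q y)) = free_mul (hpart p x) (hpart q y).
Proof.
apply/malgP => w; rewrite [LHS]free_hpartE; case: eqP => // nw.
rewrite mcoeffMl big1 // => u _; rewrite big1 // => v _.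
case: eqP => [wE|_]; last by rewrite mulr0n.
rewrite !free_hpartE; case: eqP => [pE|_]; last by rewrite mul0r mul0rn.
case: eqP => [qE|_]; last by rewrite mulr0 mul0rn.
by case: nw; rewrite -wE word_degM pE qE.
Qed.

HB.instance Definition _ := SuperModule_isSuperAlgebra.Build K F
  free_mulA free_mul1x free_mulx1 free_mul_linear_l free_mul_linear_r free_hpartM.

End Free.

Section Quotient.
Context (R : comNzRingType) (A : superAlgType R) (S : A -> Prop).

(** The smallest graded two-sided ideal containing [S].  When the elements of
    [S] are homogeneous this is the two-sided ideal generated by [S]. *)
Inductive sideal : A -> Prop :=
| sideal_0 : sideal 0
| sideal_add x y : sideal x -> sideal y -> sideal (x + y)
| sideal_mul l x r : sideal x -> sideal (l *s x *s r)
| sideal_gen p x : S x -> sideal (hpart p x).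

Lemma sidealZ a x : sideal x -> sideal (a *: x).
Proof.
move=> h; have -> : a *: x = (a *: sone) *s x *s sone.
  by rewrite smulx1 smulZl smul1x.
exact: sideal_mul.
Qed.

Lemma sidealN x : sideal x -> sideal (- x).
Proof. by rewrite -scaleN1r; apply: sidealZ. Qed.

Lemma sideal_hpart p x : sideal x -> sideal (hpart p x).
Proof.
move=> h; elim: h p => {x} [|x y _ hx _ hy|l x r _ hx|q x Sx] p.
- by rewrite linear0; apply: sideal_0.
- by rewrite linearD; apply: sideal_add; [apply: hx|apply: hy].
- rewrite -(hpart_bigsum l) -(hpart_bigsum x) -(hpart_bigsum r).
  rewrite smul_suml smul_suml linear_sum; apply: (big_ind sideal) => [||d _].
  + exact: sideal_0.
  + exact: sideal_add.
  rewrite smul_sumr linear_sum; apply: (big_ind sideal) => [||f _].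
  + exact: sideal_0.
  + exact: sideal_add.
  rewrite smul_sumr smul_suml linear_sum; apply: (big_ind sideal) => [||e _].
  + exact: sideal_0.
  + exact: sideal_add.
  have hh := homogM (homogM (hpart_homog d l) (hpart_homog e x)) (hpart_homog f r).
  rewrite /= (homog_hpart _ hh); case: eqP => _; last exact: sideal_0.
  by apply: sideal_mul; apply: hx.
- rewrite hpart_hpart; case: eqP => _; first exact: sideal_gen.
  exact: sideal_0.
Qed.

Definition squot_rel (x y : A) := `[< sideal (x - y) >].

Lemma squot_rel_equiv : equiv_class_of squot_rel.
Proof.
split=> [x|x y|y x z].
- by apply/asboolP; rewrite subrr; apply: sideal_0.
- by apply/asboolP/asboolP => /sidealN; rewrite opprB.
- move=> /asboolP h /asboolP h'; apply/asboolP.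
  by rewrite -(subrKA y); apply: sideal_add.
Qed.
Canonical squot_equiv := EquivRelPack squot_rel_equiv.

Definition squot : Type := {eq_quot squot_equiv}.
HB.instance Definition _ := Choice.on squot.
HB.instance Definition _ := EqQuotient.on squot.

Definition squot_proj (x : A) : squot := \pi_squot x.

Lemma squotW (P : squot -> Prop) : (forall x, P (squot_proj x)) -> forall x, P x.
Proof. by move=> h x; rewrite -[x]reprK; apply: h. Qed.

Lemma squot_eqP x y : squot_proj x = squot_proj y <-> sideal (x - y).
Proof. by split=> [/eqmodP/asboolP|h] //; apply/eqmodP/asboolP. Qed.

Lemma squot_reprP x : sideal (repr (squot_proj x) - x).
Proof. by apply/squot_eqP; rewrite /squot_proj reprK. Qed.

Definition squot_add (x y : squot) : squot := squot_proj (repr x + repr y).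
Definition squot_opp (x : squot) : squot := squot_proj (- repr x).
Definition squot_scale (a : R) (x : squot) : squot := squot_proj (a *: repr x).
Definition squot_hpart p (x : squot) : squot := squot_proj (hpart p (repr x)).
Definition squot_mul (x y : squot) : squot := squot_proj (repr x *s repr y).

Lemma squot_projD x y : squot_add (squot_proj x) (squot_proj y) = squot_proj (x + y).
Proof.
apply/squot_eqP; rewrite opprD addrACA.
by apply: sideal_add; apply: squot_reprP.
Qed.

Lemma squot_projN x : squot_opp (squot_proj x) = squot_proj (- x).
Proof. by apply/squot_eqP; rewrite -opprD; apply: sidealN; apply: squot_reprP. Qed.

Lemma squot_projZ a x : squot_scale a (squot_proj x) = squot_proj (a *: x).
Proof. by apply/squot_eqP; rewrite -scalerBr; apply/sidealZ/squot_reprP. Qed.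

Lemma squot_proj_hpart p x : squot_hpart p (squot_proj x) = squot_proj (hpart p x).
Proof. by apply/squot_eqP; rewrite -linearB; apply/sideal_hpart/squot_reprP. Qed.

Lemma squot_projM x y : squot_mul (squot_proj x) (squot_proj y) = squot_proj (x *s y).
Proof.
apply/squot_eqP; set x' := repr _; set y' := repr _.
have -> : x' *s y' - x *s y
    = sone *s (x' - x) *s y' + x *s (y' - y) *s sone.
  by rewrite smul1x smulx1 smulDl smulNl smulDr smulNr subrKA.
by apply: sideal_add; apply: sideal_mul; apply: squot_reprP.
Qed.

Lemma squot_addA : associative squot_add.
Proof.
by elim/squotW=> x; elim/squotW=> y; elim/squotW=> z; rewrite !squot_projD addrA.
Qed.
Lemma squot_addC : commutative squot_add.
Proof. by elim/squotW=> x; elim/squotW=> y; rewrite !squot_projD addrC. Qed.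
Lemma squot_add0 : left_id (squot_proj 0) squot_add.
Proof. by elim/squotW=> x; rewrite squot_projD add0r. Qed.
Lemma squot_addN : left_inverse (squot_proj 0) squot_opp squot_add.
Proof. by elim/squotW=> x; rewrite squot_projN squot_projD addNr. Qed.

HB.instance Definition _ :=
  GRing.isZmodule.Build squot squot_addA squot_addC squot_add0 squot_addN.

Lemma squot_scaleA a b x : squot_scale a (squot_scale b x) = squot_scale (a * b) x.
Proof. by elim/squotW: x => x; rewrite !squot_projZ scalerA. Qed.
Lemma squot_scale1 : left_id 1 squot_scale.
Proof. by elim/squotW=> x; rewrite squot_projZ scale1r. Qed.
Lemma squot_scaleDr : right_distributive squot_scale +%R.
Proof.
move=> a; elim/squotW=> x; elim/squotW=> y.
by rewrite [_ + _]squot_projD !squot_projZ [RHS]squot_projD scalerDr.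
Qed.
Lemma squot_scaleDl x : {morph squot_scale^~ x : a b / a + b}.
Proof.
move=> a b; elim/squotW: x => x.
by rewrite !squot_projZ [RHS]squot_projD scalerDl.
Qed.

HB.instance Definition _ := GRing.Zmodule_isLmodule.Build R squot
  squot_scaleA squot_scale1 squot_scaleDr squot_scaleDl.

Lemma squot_proj_is_linear : linear squot_proj.
Proof. by move=> a x y; rewrite -squot_projD -squot_projZ. Qed.
HB.instance Definition _ :=
  GRing.isLinear.Build R A squot _ squot_proj squot_proj_is_linear.

Lemma squot_hpart_is_linear p : linear (squot_hpart p).
Proof.
move=> a; elim/squotW=> x; elim/squotW=> y; rewrite -linearP !squot_proj_hpart -linearP.
by rewrite [hpart p (_ + _)]linearP.
Qed.
Lemma squot_hpart_sum x : squot_hpart false x + squot_hpart true x = x.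
Proof.
elim/squotW: x => x.
by rewrite !squot_proj_hpart -linearD hpart_sum.
Qed.
Lemma squot_hpart_hpart p q x :
  squot_hpart p (squot_hpart q x) = if p == q then squot_hpart q x else 0.
Proof.
elim/squotW: x => x; rewrite !squot_proj_hpart hpart_hpart.
by case: eqP => // _; rewrite linear0.
Qed.

HB.instance Definition _ := Lmodule_isSuper.Build R squot
  squot_hpart_is_linear squot_hpart_sum squot_hpart_hpart.

Lemma squot_mulA : associative squot_mul.
Proof.
by elim/squotW=> x; elim/squotW=> y; elim/squotW=> z; rewrite !squot_projM smulA.
Qed.
Lemma squot_mul1x : left_id (squot_proj sone) squot_mul.
Proof. by elim/squotW=> x; rewrite squot_projM smul1x. Qed.
Lemma squot_mulx1 : right_id (squot_proj sone) squot_mul.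
Proof. by elim/squotW=> x; rewrite squot_projM smulx1. Qed.
Lemma squot_mul_linear_l y : linear (squot_mul^~ y).
Proof.
move=> a; elim/squotW=> x; elim/squotW=> z; elim/squotW: y => y.
by rewrite -linearP !squot_projM -linearP smulDl smulZl.
Qed.
Lemma squot_mul_linear_r x : linear (squot_mul x).
Proof.
move=> a; elim/squotW=> y; elim/squotW=> z; elim/squotW: x => x.
by rewrite -linearP !squot_projM -linearP smulDr smulZr.
Qed.
Lemma squot_hpartM p q x y :
  hpart (p (+) q) (squot_mul (hpart p x) (hpart q y))
  = squot_mul (hpart p x) (hpart q y).
Proof.
elim/squotW: x => x; elim/squotW: y => y.
rewrite ![hpart p _]squot_proj_hpart ![hpart q _]squot_proj_hpart !squot_projM.
by rewrite [LHS]squot_proj_hpart hpartM.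
Qed.

HB.instance Definition _ := SuperModule_isSuperAlgebra.Build R squot
  squot_mulA squot_mul1x squot_mulx1 squot_mul_linear_l squot_mul_linear_r
  squot_hpartM.

End Quotient.

Section Subalgebra.
Context (R : comNzRingType) (A : superAlgType R) (S : A -> Prop).

(** The smallest graded unital subalgebra containing [S].  When the elements of
    [S] are homogeneous this is the unital subalgebra generated by [S]. *)
Inductive subalg : A -> Prop :=
| subalg_one : subalg sone
| subalg_scale a x : subalg x -> subalg (a *: x)
| subalg_add x y : subalg x -> subalg y -> subalg (x + y)
| subalg_mul x y : subalg x -> subalg y -> subalg (x *s y)
| subalg_gen p x : S x -> subalg (hpart p x).

Lemma subalg_gen1 x : S x -> subalg x.
Proof.
by move=> Sx; rewrite -(hpart_sum x); apply: subalg_add; apply: subalg_gen.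
Qed.

Lemma subalg0 : subalg 0.
Proof. by rewrite -(scale0r sone); apply/subalg_scale/subalg_one. Qed.

Lemma subalg_hpart p x : subalg x -> subalg (hpart p x).
Proof.
move=> h; elim: h p => {x} [|a x _ hx|x y _ hx _ hy|x y _ hx _ hy|q x Sx] p.
- rewrite (homog_hpart _ (homog1 A)); case: eqP => _; first exact: subalg_one.
  exact: subalg0.
- by rewrite linearZ; apply: subalg_scale; apply: hx.
- by rewrite linearD; apply: subalg_add; [apply: hx|apply: hy].
- rewrite -(hpart_bigsum x) -(hpart_bigsum y).
  rewrite smul_suml linear_sum; apply: (big_ind subalg) => [||d _].
  + exact: subalg0.
  + exact: subalg_add.
  rewrite !smul_sumr linear_sum; apply: (big_ind subalg) => [||e _].
  + exact: subalg0.
  + exact: subalg_add.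
  have hh := homogM (hpart_homog d x) (hpart_homog e y).
  rewrite /= (homog_hpart _ hh); case: eqP => _; last exact: subalg0.
  by apply: subalg_mul; [apply: hx|apply: hy].
- rewrite hpart_hpart; case: eqP => _; first exact: subalg_gen.
  exact: subalg0.
Qed.

Definition subalg_pred : pred A := fun x => `[< subalg x >].

Lemma subalg_submod_closed : submod_closed subalg_pred.
Proof.
split=> [|a x y]; first exact/asboolP/subalg0.
move=> /asboolP hx /asboolP hy; apply/asboolP.
by apply: subalg_add hy; apply: subalg_scale.
Qed.
HB.instance Definition _ :=
  GRing.isSubmodClosed.Build R A subalg_pred subalg_submod_closed.

Record gensub : Type := GenSub { gensub_val : A; _ : gensub_val \in subalg_pred }.
HB.instance Definition _ := [isSub for gensub_val].
HB.instance Definition _ := [Choice of gensub by <:].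
HB.instance Definition _ := [SubChoice_isSubLmodule of gensub by <:].

Lemma gensub_valP (x : gensub) : subalg (gensub_val x).
Proof. by apply/asboolP; case: x. Qed.

Definition mk_gensub (x : A) (h : subalg x) : gensub := GenSub (asboolT h).

Lemma mk_gensubK x (h : subalg x) : gensub_val (mk_gensub h) = x.
Proof. by []. Qed.

Lemma gensub_val_is_linear : linear gensub_val.
Proof. by []. Qed.
HB.instance Definition _ :=
  GRing.isLinear.Build R gensub A _ gensub_val gensub_val_is_linear.

Definition gensub_hpart p x := mk_gensub (subalg_hpart p (gensub_valP x)).
Definition gensub_one := mk_gensub subalg_one.
Definition gensub_mul x y := mk_gensub (subalg_mul (gensub_valP x) (gensub_valP y)).

Lemma gensub_hpart_is_linear p : linear (gensub_hpart p).
Proof. by move=> a x y; apply: val_inj; rewrite /= !linearP. Qed.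
Lemma gensub_hpart_sum x : gensub_hpart false x + gensub_hpart true x = x.
Proof. by apply: val_inj; rewrite /= hpart_sum. Qed.
Lemma gensub_hpart_hpart p q x :
  gensub_hpart p (gensub_hpart q x) = if p == q then gensub_hpart q x else 0.
Proof. by apply: val_inj; rewrite /= hpart_hpart; case: eqP. Qed.
HB.instance Definition _ := Lmodule_isSuper.Build R gensub
  gensub_hpart_is_linear gensub_hpart_sum gensub_hpart_hpart.

Lemma gensub_mulA : associative gensub_mul.
Proof. by move=> x y z; apply: val_inj; rewrite /= smulA. Qed.
Lemma gensub_mul1x : left_id gensub_one gensub_mul.
Proof. by move=> x; apply: val_inj; rewrite /= smul1x. Qed.
Lemma gensub_mulx1 : right_id gensub_one gensub_mul.
Proof. by move=> x; apply: val_inj; rewrite /= smulx1. Qed.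
Lemma gensub_mul_linear_l y : linear (gensub_mul^~ y).
Proof. by move=> a x z; apply: val_inj; rewrite /= smulDl smulZl. Qed.
Lemma gensub_mul_linear_r x : linear (gensub_mul x).
Proof. by move=> a y z; apply: val_inj; rewrite /= smulDr smulZr. Qed.
Lemma gensub_hpartM p q x y :
  hpart (p (+) q) (gensub_mul (hpart p x) (hpart q y))
  = gensub_mul (hpart p x) (hpart q y).
Proof. by apply: val_inj; rewrite /= hpartM. Qed.
HB.instance Definition _ := SuperModule_isSuperAlgebra.Build R gensub
  gensub_mulA gensub_mul1x gensub_mulx1 gensub_mul_linear_l gensub_mul_linear_r
  gensub_hpartM.

End Subalgebra.

(** The [n]-th term of the sequence is the coefficient of [h^n]. *)
Definition fps (K : Type) : Type := nat -> K.

Section Fps.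
Context (K : comNzRingType).
Implicit Types f g k : fps K.

HB.instance Definition _ := gen_eqMixin (fps K).
HB.instance Definition _ := gen_choiceMixin (fps K).

Definition fps_zero : fps K := fun _ => 0.
Definition fps_one : fps K := fun n => (n == 0%N)%:R.
Definition fps_opp f : fps K := fun n => - f n.
Definition fps_add f g : fps K := fun n => f n + g n.
Definition fps_mul f g : fps K := fun n => \sum_(i < n.+1) f i * g (n - i)%N.
Definition fps_scale (a : K) f : fps K := fun n => a * f n.

Definition fps_trunc m f : {poly K} := \poly_(i < m) f i.

Lemma fps_truncM m n f g : (n < m)%N ->
  (fps_trunc m f * fps_trunc m g)`_n = fps_mul f g n.
Proof.
move=> nm; rewrite coefM; apply: eq_bigr => i _; rewrite !coef_poly.
have im : (i < m)%N by apply: leq_trans (ltn_ord i) nm.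
by rewrite im (leq_ltn_trans (leq_subr i n) nm).
Qed.

Lemma fps_trunc_coef m n f : (n < m)%N -> (fps_trunc m f)`_n = f n.
Proof. by move=> nm; rewrite coef_poly nm. Qed.

Lemma fps_addA : associative fps_add.
Proof. by move=> f g k; apply/funext => n; apply: addrA. Qed.
Lemma fps_addC : commutative fps_add.
Proof. by move=> f g; apply/funext => n; apply: addrC. Qed.
Lemma fps_add0 : left_id fps_zero fps_add.
Proof. by move=> f; apply/funext => n; apply: add0r. Qed.
Lemma fps_addN : left_inverse fps_zero fps_opp fps_add.
Proof. by move=> f; apply/funext => n; apply: addNr. Qed.
HB.instance Definition _ :=
  GRing.isZmodule.Build (fps K) fps_addA fps_addC fps_add0 fps_addN.

Lemma fps_mulC : commutative fps_mul.
Proof.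
by move=> f g; apply/funext => n; rewrite -!(fps_truncM _ _ (ltnSn n)) mulrC.
Qed.
Lemma fps_mulA : associative fps_mul.
Proof.
move=> f g k; apply/funext => n.
have E f1 f2 f3 : (fps_trunc n.+1 f1 * (fps_trunc n.+1 f2 * fps_trunc n.+1 f3))`_n
    = fps_mul f1 (fps_mul f2 f3) n.
  rewrite coefM; apply: eq_bigr => i _.
  by rewrite fps_trunc_coef ?ltn_ord // fps_truncM // ltnS leq_subr.
by rewrite -E mulrA [_ * fps_trunc _ k]mulrC E fps_mulC.
Qed.
Lemma fps_mul1 : left_id fps_one fps_mul.
Proof.
move=> f; apply/funext => n; rewrite /fps_mul big_ord_recl big1 ?addr0 /fps_one.
  by rewrite mul1r subn0.
by move=> i _; rewrite mul0r.
Qed.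
Lemma fps_mulDl : left_distributive fps_mul +%R.
Proof.
move=> f g k; apply/funext => n; rewrite /fps_mul -[RHS]big_split.
by apply: eq_bigr => i _; apply: mulrDl.
Qed.
Lemma fps_one_neq0 : fps_one != 0.
Proof. by apply/eqP => /(congr1 (fun f => f 0%N)) /eqP; rewrite oner_eq0. Qed.
HB.instance Definition _ := GRing.Zmodule_isComNzRing.Build (fps K)
  fps_mulA fps_mulC fps_mul1 fps_mulDl fps_one_neq0.

Lemma fps_scaleA a b f : fps_scale a (fps_scale b f) = fps_scale (a * b) f.
Proof. by apply/funext => n; apply: mulrA. Qed.
Lemma fps_scale1 : left_id 1 fps_scale.
Proof. by move=> f; apply/funext => n; apply: mul1r. Qed.
Lemma fps_scaleDr : right_distributive fps_scale +%R.
Proof. by move=> a f g; apply/funext => n; apply: mulrDr. Qed.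
Lemma fps_scaleDl f : {morph fps_scale^~ f : a b / a + b}.
Proof. by move=> a b; apply/funext => n; apply: mulrDl. Qed.
HB.instance Definition _ := GRing.Zmodule_isLmodule.Build K (fps K)
  fps_scaleA fps_scale1 fps_scaleDr fps_scaleDl.

(** [fps K] is purely even. *)
Definition fps_hpart (p : bool) f : fps K := if p then 0 else f.
Lemma fps_hpart_is_linear p : linear (fps_hpart p).
Proof. by case: p => a f g //=; rewrite scaler0 addr0. Qed.
Lemma fps_hpart_sum f : fps_hpart false f + fps_hpart true f = f.
Proof. exact: addr0. Qed.
Lemma fps_hpart_hpart p q f :
  fps_hpart p (fps_hpart q f) = if p == q then fps_hpart q f else 0.
Proof. by case: p; case: q. Qed.
HB.instance Definition _ := Lmodule_isSuper.Build K (fps K)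
  fps_hpart_is_linear fps_hpart_sum fps_hpart_hpart.

Lemma fps_scaleAl a f g : a *: (f * g) = (a *: f) * g.
Proof.
apply/funext => n.
transitivity (a * \sum_(i < n.+1) f i * g (n - i)%N); first by [].
transitivity (\sum_(i < n.+1) (a * f i) * g (n - i)%N); last by [].
by rewrite mulr_sumr; apply: eq_bigr => i _; rewrite mulrA.
Qed.
Lemma fps_mul_linear_l g : linear (fun f : fps K => f * g).
Proof. by move=> a f f'; rewrite mulrDl fps_scaleAl. Qed.
Lemma fps_mul_linear_r f : linear (fun g : fps K => f * g).
Proof. by move=> a g g'; rewrite ![f * _]mulrC mulrDl fps_scaleAl. Qed.
Lemma fps_hpartM p q f g :
  hpart (p (+) q) (hpart p f * hpart q g) = hpart p f * hpart q g.
Proof.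
case: p; case: q; rewrite /hpart /= ?mul0r ?mulr0 //.
Qed.
HB.instance Definition _ := SuperModule_isSuperAlgebra.Build K (fps K)
  (@mulrA (fps K)) (@mul1r (fps K)) (@mulr1 (fps K))
  fps_mul_linear_l fps_mul_linear_r fps_hpartM.

Definition hvar : fps K := fun n => (n == 1%N)%:R.

Definition fps_ev0 f : K := f 0%N.

End Fps.

(** [hext A] is [fps K ⊗[K] A], regarded as a superalgebra over [fps K]. *)
Definition hext (K : comNzRingType) (A : superAlgType K) : Type := fps K ⊗[K] A.

Section Hext.
Context (K : comNzRingType) (A : superAlgType K).
Implicit Types (f g : fps K) (x y : hext A).

HB.instance Definition _ := GRing.Zmodule.copy (hext A) (fps K ⊗[K] A).

Definition hext_scale f x : hext A := (f ⊗ (sone : A)) *s (x : fps K ⊗[K] A).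

Lemma fps_even f : homog false f.
Proof. by []. Qed.

Lemma hext_scale_pure f g (a : A) : hext_scale f (g ⊗ a) = (f * g) ⊗ a.
Proof.
by rewrite /hext_scale [LHS](tens_mul_pure _ _ (homog1 _) (fps_even g)) scale1r smul1x.
Qed.

Lemma hext_scaleA f g x : hext_scale f (hext_scale g x) = hext_scale (f * g) x.
Proof. by rewrite /hext_scale smulA -[f ⊗ _ *s _]/(hext_scale f _) hext_scale_pure. Qed.
Lemma hext_scale1 : left_id 1 hext_scale.
Proof. by move=> x; apply: smul1x. Qed.
Lemma hext_scaleDr : right_distributive hext_scale +%R.
Proof. by move=> f x y; apply: smulDr. Qed.
Lemma hext_scaleDl x : {morph hext_scale^~ x : f g / f + g}.
Proof. by move=> f g; rewrite /hext_scale pureDl; apply: smulDl. Qed.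
HB.instance Definition _ := GRing.Zmodule_isLmodule.Build (fps K) (hext A)
  hext_scaleA hext_scale1 hext_scaleDr hext_scaleDl.

Definition hext_hpart p x : hext A := hpart p (x : fps K ⊗[K] A).
Definition hext_one : hext A := (sone : fps K ⊗[K] A).
Definition hext_mul x y : hext A :=
  (x : fps K ⊗[K] A) *s (y : fps K ⊗[K] A).

Lemma homog_scal f : homog false (f ⊗ (sone : A)).
Proof. by rewrite /homog (hpart_pure _ (fps_even f) (homog1 _)). Qed.

Lemma hext_hpart_is_linear p : linear (hext_hpart p).
Proof.
move=> f x y; rewrite /hext_hpart.
rewrite [hpart p (_ + _)]linearD; congr (_ + _).
rewrite /GRing.scale /= /hext_scale.
rewrite -{1}(hpart_bigsum (x : fps K ⊗[K] A)) smul_sumr linear_sum /=.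
rewrite (bigD1 p) //= big1 ?addr0 => [|q /negbTE nq].
  by rewrite (homog_hpart _ (homogM (homog_scal f) (hpart_homog p _))) /= eqxx.
by rewrite (homog_hpart _ (homogM (homog_scal f) (hpart_homog q _))) /= eq_sym nq.
Qed.
Lemma hext_hpart_sum x : hext_hpart false x + hext_hpart true x = x.
Proof. exact: hpart_sum. Qed.
Lemma hext_hpart_hpart p q x :
  hext_hpart p (hext_hpart q x) = if p == q then hext_hpart q x else 0.
Proof. exact: hpart_hpart. Qed.
HB.instance Definition _ := Lmodule_isSuper.Build (fps K) (hext A)
  hext_hpart_is_linear hext_hpart_sum hext_hpart_hpart.

Lemma scal_central f (x : fps K ⊗[K] A) :
  x *s (f ⊗ sone) = (f ⊗ sone) *s x.
Proof.
elim/tens_hind: x => [|x y hx hy|p q g a hg ha].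
- by rewrite smul0x smulx0.
- by rewrite smulDl smulDr hx hy.
rewrite [LHS](tens_mul_pure _ _ ha (fps_even f)).
rewrite [RHS](tens_mul_pure _ _ (homog1 _) hg) andbF !scale1r.
by rewrite smul1x smulx1 [g *s f]mulrC.
Qed.

Lemma hext_mulA : associative hext_mul.
Proof. by move=> x y z; apply: smulA. Qed.
Lemma hext_mul1x : left_id hext_one hext_mul.
Proof. by move=> x; apply: smul1x. Qed.
Lemma hext_mulx1 : right_id hext_one hext_mul.
Proof. by move=> x; apply: smulx1. Qed.
Lemma hext_mul_linear_l y : linear (hext_mul^~ y).
Proof.
move=> f x z; rewrite /hext_mul [LHS]smulDl; congr (_ + _).
by rewrite /GRing.scale /= /hext_scale smulA.
Qed.
Lemma hext_mul_linear_r x : linear (hext_mul x).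
Proof.
move=> f y z; rewrite /hext_mul [LHS]smulDr; congr (_ + _).
by rewrite /GRing.scale /= /hext_scale !smulA scal_central.
Qed.
Lemma hext_hpartM p q x y :
  hpart (p (+) q) (hext_mul (hpart p x) (hpart q y))
  = hext_mul (hpart p x) (hpart q y).
Proof. by rewrite /hext_mul; apply: (hpartM p q (x : fps K ⊗[K] A)). Qed.
HB.instance Definition _ := SuperModule_isSuperAlgebra.Build (fps K) (hext A)
  hext_mulA hext_mul1x hext_mulx1 hext_mul_linear_l hext_mul_linear_r hext_hpartM.

Definition hext_pure f (a : A) : hext A := f ⊗ a.

End Hext.

(** The index [(b, a)] stands for the integer [(-1)^b (a + 1)]. *)
Definition idx (N : nat) : predArgType := (bool * 'I_N)%type.
HB.instance Definition _ N := Finite.on (idx N).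

Definition bar N (i : idx N) : bool := i.1.
Definition ineg N (i : idx N) : idx N := (~~ i.1, i.2).

Lemma inegK N : involutive (@ineg N).
Proof. by case=> b a; rewrite /ineg /= negbK. Qed.

(** [gl N K] is the associative superalgebra of endomorphisms of [K^(N|N)]. *)
Definition gl (N : nat) (K : comNzRingType) : Type := 'M[K]_#|idx N|.

Section Gl.
Context (N : nat) (K : comNzRingType).
Implicit Types X Y : gl N K.

HB.instance Definition _ := GRing.Lmodule.copy (gl N K) 'M[K]_#|idx N|.

Definition matunit (i j : idx N) : gl N K := delta_mx (enum_rank i) (enum_rank j).

Definition gl_hpart p X : gl N K :=
  \matrix_(a, b) if bar (enum_val a) (+) bar (enum_val b) == p then X a b else 0.

Lemma gl_hpart_is_linear p : linear (gl_hpart p).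
Proof.
move=> a X Y; apply/matrixP => i j; rewrite !mxE.
by case: eqP => _; rewrite ?mulr0 ?addr0.
Qed.
Lemma gl_hpart_sum X : gl_hpart false X + gl_hpart true X = X.
Proof.
apply/matrixP => i j; rewrite !mxE.
by case: (_ (+) _); rewrite /= ?addr0 ?add0r.
Qed.
Lemma gl_hpart_hpart p q X :
  gl_hpart p (gl_hpart q X) = if p == q then gl_hpart q X else 0.
Proof.
apply/matrixP => i j; rewrite !(mxE, fun_if (fun M : 'M[K]_#|idx N| => M i j)).
by case: (_ (+) _); case: p; case: q.
Qed.
HB.instance Definition _ := Lmodule_isSuper.Build K (gl N K)
  gl_hpart_is_linear gl_hpart_sum gl_hpart_hpart.

Definition gl_one : gl N K := 1%:M.
Definition gl_mul X Y : gl N K := X *m Y.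

Lemma gl_mulA : associative gl_mul.
Proof. exact: mulmxA. Qed.
Lemma gl_mul1x : left_id gl_one gl_mul.
Proof. exact: mul1mx. Qed.
Lemma gl_mulx1 : right_id gl_one gl_mul.
Proof. exact: mulmx1. Qed.
Lemma gl_mul_linear_l Y : linear (gl_mul^~ Y).
Proof. by move=> a X Z; rewrite /gl_mul [LHS]mulmxDl -scalemxAl. Qed.
Lemma gl_mul_linear_r X : linear (gl_mul X).
Proof. by move=> a Y Z; rewrite /gl_mul [LHS]mulmxDr -scalemxAr. Qed.
Lemma gl_hpartM p q X Y :
  hpart (p (+) q) (gl_mul (hpart p X) (hpart q Y)) = gl_mul (hpart p X) (hpart q Y).
Proof.
apply/matrixP => i j; rewrite mxE; case: eqP => // nij.
rewrite mxE big1 // => k _; rewrite !mxE.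
case: eqP => [pE|_]; last by rewrite mul0r.
case: eqP => [qE|_]; last by rewrite mulr0.
by case: nij; rewrite -pE -qE; case: (bar _); case: (bar _); case: (bar _).
Qed.
HB.instance Definition _ := SuperModule_isSuperAlgebra.Build K (gl N K)
  gl_mulA gl_mul1x gl_mulx1 gl_mul_linear_l gl_mul_linear_r gl_hpartM.

Definition eta X : gl N K :=
  \matrix_(a, b) X (enum_rank (ineg (enum_val a))) (enum_rank (ineg (enum_val b))).

Lemma eta_matunit i j : eta (matunit i j) = matunit (ineg i) (ineg j).
Proof.
apply/matrixP => a b; rewrite !mxE.
have E (c : 'I_#|idx N|) k : (enum_rank (ineg (enum_val c)) == enum_rank k)
    = (c == enum_rank (ineg k)).
  by rewrite -(inj_eq enum_val_inj) !enum_rankK -{1}[k]inegK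
    (inj_eq (inv_inj (@inegK N))) -(inj_eq enum_val_inj) enum_rankK.
by rewrite !E.
Qed.

Lemma eta_hom : is_superalg_hom id eta.
Proof.
split.
- by move=> X Y; apply/matrixP => i j; rewrite !mxE.
- by move=> a X; apply/matrixP => i j; rewrite !mxE.
- apply/matrixP => i j; rewrite !mxE (inj_eq enum_rank_inj).
  by rewrite (inj_eq (inv_inj (@inegK N))) (inj_eq enum_val_inj).
- move=> X Y; apply/matrixP => i j; rewrite !mxE.
  have inv : involutive (fun c : 'I_#|idx N| => enum_rank (ineg (enum_val c))).
    by move=> c; rewrite enum_rankK inegK enum_valK.
  rewrite (reindex_inj (inv_inj inv)) /=.
  by apply: eq_bigr => k _; rewrite !mxE.
- move=> p X; apply/matrixP => i j; rewrite !mxE !enum_rankK /bar /=.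
  by rewrite addbN addNb negbK.
Qed.

End Gl.

Lemma shom_sbracket (R R' : comNzRingType) (sg : {rmorphism R -> R'})
    (A : superAlgType R) (B : superAlgType R') (f : A -> B) :
  is_superalg_hom sg f -> forall x y, f (sbracket x y) = sbracket (f x) (f y).
Proof.
move=> hf x y; have f0 : f 0 = 0.
  by rewrite -(scale0r (0 : A)) (shom_scale hf) rmorph0 scale0r.
have fS I r (F : I -> A) : f (\sum_(i <- r) F i) = \sum_(i <- r) f (F i).
  exact: (big_morph f (shom_add hf) f0).
rewrite /sbracket fS; apply: eq_bigr => p _; rewrite fS; apply: eq_bigr => q _.
rewrite (shom_add hf) -scaleN1r !(shom_scale hf) !(shom_mul hf) !(shom_hpart hf).
by rewrite rmorph_sign rmorphN1 scaleN1r.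
Qed.

Section Current.
Context (N : nat) (K : comNzRingType).

(** [X(u) |-> X(-u)], for [X(u)] a matrix with entries in [K[u]]. *)
Definition uflip (X : gl N {poly K}) : gl N {poly K} :=
  map_mx (comp_poly (- 'X)) X.

Lemma uflip_hom : is_superalg_hom (comp_poly (- 'X)) uflip.
Proof.
split.
- by move=> X Y; apply: map_mxD.
- by move=> a X; apply: map_mxZ.
- exact: map_mx1.
- by move=> X Y; apply: map_mxM.
- move=> p X; apply/matrixP => i j; rewrite !mxE.
  by case: eqP; rewrite ?comp_poly0.
Qed.

Record tcur : Type := TCur { tcur_val : gl N {poly K}; _ : eta tcur_val == uflip tcur_val }.
HB.instance Definition _ := [isSub for tcur_val].
HB.instance Definition _ := [Choice of tcur by <:].
Implicit Types x y : tcur.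

Lemma tcurP x : eta (tcur_val x) = uflip (tcur_val x).
Proof. by apply/eqP; case: x. Qed.

Definition mk_tcur X (h : eta X = uflip X) : tcur := TCur (introT eqP h).

Lemma tcur_zero_subproof : eta 0 = uflip (0 : gl N {poly K}).
Proof. by apply/matrixP => i j; rewrite !mxE comp_poly0. Qed.
Lemma tcur_opp_subproof x : eta (- tcur_val x) = uflip (- tcur_val x).
Proof.
have := tcurP x => /matrixP h; apply/matrixP => i j.
by have := h i j; rewrite !mxE => ->; rewrite rmorphN.
Qed.
Lemma tcur_add_subproof x y :
  eta (tcur_val x + tcur_val y) = uflip (tcur_val x + tcur_val y).
Proof. by rewrite (shom_add (@eta_hom _ _)) (shom_add uflip_hom) !tcurP. Qed.
Lemma tcur_scale_subproof (a : K) x :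
  eta (a%:P *: tcur_val x) = uflip (a%:P *: tcur_val x).
Proof.
by rewrite (shom_scale (@eta_hom _ _)) (shom_scale uflip_hom) tcurP comp_polyC.
Qed.
Lemma tcur_hpart_subproof p x : eta (hpart p (tcur_val x)) = uflip (hpart p (tcur_val x)).
Proof. by rewrite (shom_hpart (@eta_hom _ _)) (shom_hpart uflip_hom) tcurP. Qed.
Lemma tcur_br_subproof x y :
  eta (sbracket (tcur_val x) (tcur_val y)) = uflip (sbracket (tcur_val x) (tcur_val y)).
Proof.
rewrite (shom_sbracket (sg := idfun) (@eta_hom _ _)) (shom_sbracket uflip_hom).
by rewrite !tcurP.
Qed.

Definition tcur_zero := mk_tcur tcur_zero_subproof.
Definition tcur_opp x := mk_tcur (tcur_opp_subproof x).
Definition tcur_add x y := mk_tcur (tcur_add_subproof x y).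
Definition tcur_scale a x := mk_tcur (tcur_scale_subproof a x).
Definition tcur_hpart p x := mk_tcur (tcur_hpart_subproof p x).

Definition tcur_br x y := mk_tcur (tcur_br_subproof x y).

Lemma tcur_addA : associative tcur_add.
Proof. by move=> x y z; apply: val_inj; apply: addrA. Qed.
Lemma tcur_addC : commutative tcur_add.
Proof. by move=> x y; apply: val_inj; apply: addrC. Qed.
Lemma tcur_add0 : left_id tcur_zero tcur_add.
Proof. by move=> x; apply: val_inj; apply: add0r. Qed.
Lemma tcur_addN : left_inverse tcur_zero tcur_opp tcur_add.
Proof. by move=> x; apply: val_inj; apply: addNr. Qed.
HB.instance Definition _ :=
  GRing.isZmodule.Build tcur tcur_addA tcur_addC tcur_add0 tcur_addN.

Lemma tcur_scaleA a b x : tcur_scale a (tcur_scale b x) = tcur_scale (a * b) x.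
Proof. by apply: val_inj; rewrite /= scalerA polyCM. Qed.
Lemma tcur_scale1 : left_id 1 tcur_scale.
Proof. by move=> x; apply: val_inj; apply: scale1r. Qed.
Lemma tcur_scaleDr : right_distributive tcur_scale +%R.
Proof. by move=> a x y; apply: val_inj; apply: scalerDr. Qed.
Lemma tcur_scaleDl x : {morph tcur_scale^~ x : a b / a + b}.
Proof. by move=> a b; apply: val_inj; rewrite /= polyCD scalerDl. Qed.
HB.instance Definition _ := GRing.Zmodule_isLmodule.Build K tcur
  tcur_scaleA tcur_scale1 tcur_scaleDr tcur_scaleDl.

Lemma tcur_hpart_is_linear p : linear (tcur_hpart p).
Proof. by move=> a x y; apply: val_inj; rewrite /= linearD linearZ. Qed.
Lemma tcur_hpart_sum x : tcur_hpart false x + tcur_hpart true x = x.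
Proof. by apply: val_inj; apply: hpart_sum. Qed.
Lemma tcur_hpart_hpart p q x :
  tcur_hpart p (tcur_hpart q x) = if p == q then tcur_hpart q x else 0.
Proof. by apply: val_inj; rewrite /= hpart_hpart; case: eqP. Qed.
HB.instance Definition _ := Lmodule_isSuper.Build K tcur
  tcur_hpart_is_linear tcur_hpart_sum tcur_hpart_hpart.

Lemma tcur_F_subproof (i j : idx N) s :
  let X := 'X^s *: matunit {poly K} i j
           + (- 'X) ^+ s *: matunit {poly K} (ineg i) (ineg j) in
  eta X = uflip X.
Proof.
move=> X; rewrite /X !(shom_add (@eta_hom _ _)) !(shom_add uflip_hom).
rewrite !(shom_scale (@eta_hom _ _)) !(shom_scale uflip_hom) !eta_matunit !inegK.
have E k l : uflip (matunit {poly K} k l) = matunit {poly K} k l.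
  by apply: map_delta_mx.
by rewrite !E !rmorphXn rmorphN /= comp_polyX opprK addrC.
Qed.

(** [F_ij^(s) = E_ij u^s + E_(-i,-j) (-u)^s]. *)
Definition curF (i j : idx N) s : tcur := mk_tcur (tcur_F_subproof i j s).

End Current.

Section Enveloping.
Context (N : nat) (K : comNzRingType).
Local Notation g := (tcur N K).

(** The generator [(p, x)] stands for the component of degree [p] of [x]. *)
Definition env_free : Type := @free_salg K (bool * g)%type fst.
HB.instance Definition _ := SuperAlgebra.on env_free.

Definition env_gen p (x : g) : env_free := @gen K (bool * g)%type fst (p, x).

Inductive env_rel : env_free -> Prop :=
| env_linear p a x y :
    env_rel (env_gen p (a *: x + y) - (a *: env_gen p x + env_gen p y))
| env_part p q x :
    env_rel (env_gen p (hpart q x) - (if p == q then env_gen p x else 0))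
| env_comm p q x y :
    env_rel (env_gen p x *s env_gen q y
             - (-1) ^+ (p && q) *: (env_gen q y *s env_gen p x)
             - env_gen (p (+) q) (tcur_br (hpart p x) (hpart q y))).

Definition env : Type := squot env_rel.
HB.instance Definition _ := SuperAlgebra.on env.

Definition env_in (x : g) : env :=
  squot_proj env_rel (env_gen false x + env_gen true x).

Definition is_env_comult (D : env -> env ⊗[K] env) : Prop :=
  is_superalg_hom id D /\ forall x, D (env_in x) = env_in x ⊗ sone + sone ⊗ env_in x.

End Enveloping.

Section CoPoisson.
Context (N : nat) (K : fieldType).

(** [{fraction {poly {poly K}}}] is the field [K(u, v)], with [u] the inner
    variable and [v] the outer one. *)
Definition Kuv : fieldType := {fraction {poly {poly K}}}.
Definition uvar : Kuv := tofrac ('X%:P).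
Definition vvar : Kuv := tofrac 'X.

Definition rmat : gl N Kuv ⊗[Kuv] gl N Kuv :=
  \sum_(i : idx N) \sum_(j : idx N)
     ((-1) ^+ bar j / (uvar - vvar)) *: (matunit Kuv i j ⊗ matunit Kuv j i)
  + \sum_(i : idx N) \sum_(j : idx N)
     ((-1) ^+ bar j / (uvar + vvar)) *: (matunit Kuv i j ⊗ matunit Kuv (ineg j) (ineg i)).

Definition in_u (x : tcur N K) : gl N Kuv :=
  map_mx (fun p : {poly K} => tofrac p%:P) (tcur_val x).
Definition in_v (x : tcur N K) : gl N Kuv :=
  map_mx (fun p : {poly K} => tofrac (map_poly polyC p)) (tcur_val x).

(** [tens_map in_u in_v] is the embedding of [g ⊗ g] into [gl[u] ⊗ gl[v]],
    the latter regarded inside [gl ⊗ gl] over [K(u, v)]. *)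
Definition is_cobracket (phi0 : tcur N K -> tcur N K ⊗[K] tcur N K) : Prop :=
  forall x, tens_map in_u in_v (phi0 x)
    = sbracket (in_u x ⊗ (sone : gl N Kuv) + (sone : gl N Kuv) ⊗ in_v x) rmat.

Definition is_coPoisson (phi0 : tcur N K -> tcur N K ⊗[K] tcur N K)
    (D phi : env N K -> env N K ⊗[K] env N K) : Prop :=
  [/\ linear phi,
      forall x, phi (env_in x) = tens_map (@env_in N K) (@env_in N K) (phi0 x)
    & forall X Y, phi (X *s Y) = phi X *s D Y + D X *s phi Y].

End CoPoisson.

Section Yangian.
Context (N : nat) (K : comNzRingType).
Local Notation I := (idx N).

(** The generator [(i, j, s)] is [T_ij^(s+1)]. *)
Definition yang_deg (t : I * I * nat) : bool := bar t.1.1 (+) bar t.1.2.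
Definition yang_free : Type := @free_salg K (I * I * nat)%type yang_deg.
HB.instance Definition _ := SuperAlgebra.on yang_free.

(** The coefficient of [u^(-m)] in [T_ij(u)]. *)
Definition yang_T (i j : I) (m : int) : yang_free :=
  match m with
  | Posz 0 => (i == j)%:R *: sone
  | Posz s.+1 => @gen K (I * I * nat)%type yang_deg (i, j, s)
  | Negz _ => 0
  end.

(** A series in [u] and [v] is given by its coefficients at [u^(-m) v^(-n)];
    these are its products with [u] and with [v]. *)
Definition mulu (f : int -> int -> yang_free) : int -> int -> yang_free :=
  fun m n => f (m + 1)%R n.
Definition mulv (f : int -> int -> yang_free) : int -> int -> yang_free :=
  fun m n => f m (n + 1)%R.

(** [T_ij(u) T_kl(v)] and [T_ij(v) T_kl(u)]. *)
Definition Tuv (i j k l : I) : int -> int -> yang_free :=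
  fun m n => yang_T i j m *s yang_T k l n.
Definition Tvu (i j k l : I) : int -> int -> yang_free :=
  fun m n => yang_T i j n *s yang_T k l m.

Definition yang_br (i j k l : I) : int -> int -> yang_free :=
  fun m n => sbracket (yang_T i j m) (yang_T k l n).

Inductive yang_rel : yang_free -> Prop :=
| yang_rtt (i j k l : I) (m n : int) :
    let C := yang_br i j k l in
    let P m n := Tuv k j i l m n - Tvu k j i l m n in
    let Q m n := Tuv (ineg k) j (ineg i) l m n - Tvu k (ineg j) i (ineg l) m n in
    yang_rel
      ((-1) ^+ ((bar i && bar k) (+) (bar i && bar l) (+) (bar k && bar l))
         *: (mulu (mulu C) m n - mulv (mulv C) m n)
       - ((mulu P m n + mulv P m n)
          - (-1) ^+ (bar k (+) bar l) *: (mulu Q m n - mulv Q m n)))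
| yang_neg (i j : I) (s : nat) :
    yang_rel ((-1) ^+ s *: yang_T i j s - yang_T (ineg i) (ineg j) s).

Definition yang : Type := squot yang_rel.
HB.instance Definition _ := SuperAlgebra.on yang.

(** [T_ij^(s)], with [T_ij^(0)] the Kronecker delta. *)
Definition Tgen (i j : I) (s : nat) : yang := squot_proj yang_rel (yang_T i j s).

Definition is_yang_comult (D : yang -> yang ⊗[K] yang) : Prop :=
  is_superalg_hom id D /\
  forall i j s, D (Tgen i j s) =
    \sum_(k : I) \sum_(a < s.+1)
      (-1) ^+ ((bar i (+) bar k) && (bar j (+) bar k))
        *: (Tgen i k a ⊗ Tgen k j (s - a)).

(** [H_ij^(s+1) = T_ij^(s+1) h^s]. *)
Definition Hamb (i j : I) (s : nat) : hext yang :=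
  hext_pure (hvar K ^+ s) (Tgen i j s.+1).

Definition Yh : Type := gensub (fun x => exists i j s, x = Hamb i j s).
HB.instance Definition _ := SuperAlgebra.on Yh.

Definition Yh_val : Yh -> hext yang := @gensub_val _ _ _.

Lemma Hamb_in i j s : subalg (fun x => exists i j s, x = Hamb i j s) (Hamb i j s).
Proof. by apply: subalg_gen1; exists i, j, s. Qed.

Definition Hgen (i j : I) (s : nat) : Yh := mk_gensub (Hamb_in i j s).

(** The [fps K]-linear extension of the comultiplication of [yang]. *)
Definition comult_ext (D : yang -> yang ⊗[K] yang) :
    hext yang -> hext yang ⊗[fps K] hext yang :=
  tens_lift (fun (f : fps K) (y : yang) =>
    f *: tens_map (fun x => hext_pure 1 x) (fun x => hext_pure 1 x) (D y)).

Definition is_Yh_comult (D : yang -> yang ⊗[K] yang)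
    (Dh : Yh -> Yh ⊗[fps K] Yh) : Prop :=
  is_superalg_hom id Dh /\
  forall X, tens_map Yh_val Yh_val (Dh X) = comult_ext D (Yh_val X).

Definition Yh0 : Type := squot (fun X : Yh => exists Y : Yh, X = hvar K *: Y).
HB.instance Definition _ := SuperAlgebra.on Yh0.

Definition Yh_proj : Yh -> Yh0 := squot_proj _.

(** [iso] is the isomorphism of Hopf superalgebras from [Yh0] to [env], the
    coefficients [fps K] acting on [env] through [h = 0]. *)
Definition is_classical_limit (DU : env N K -> env N K ⊗[K] env N K)
    (Dh : Yh -> Yh ⊗[fps K] Yh) (iso : Yh0 -> env N K) : Prop :=
  let psi X := iso (Yh_proj X) in
  [/\ bijective iso, is_superalg_hom (@fps_ev0 K) iso,
      forall X, DU (psi X) = tens_map psi psi (Dh X)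
    & forall i j s,
        iso (Yh_proj (Hgen i j s)) = - ((-1) ^+ bar j *: env_in (curF K j i s))].

End Yangian.

(* Main.v *)
(** Call [X] good if [Delta X - Delta° X = h Z] for some [Z] whose image under
    [psi ⊗ psi] is [phi (psi X)].  Both [Delta] and [Delta°] are multiplicative
    and induce the comultiplication of [U(g)] modulo [h], so good elements form
    a subalgebra and it suffices to treat the generators.  There
    [Delta H_ij^(s+1) = H_ij^(s+1) ⊗ 1 + 1 ⊗ H_ij^(s+1) + h (...)] gives [Z]
    explicitly.  On the other side, [r = P / (u - v) + Q / (u + v)] with [P] the
    super-permutation and [Q = (id ⊗ eta) P]; commuting [X(u) ⊗ 1 + 1 ⊗ X(v)]
    past [P] exchanges the two factors, so [phi (F_ij^(s))] comes from geometric
    sums such as [(u^s - v^s) / (u - v)].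

    Identities in [Yh ⊗ Yh] and in [g ⊗ g] are checked after embedding these
    into larger tensor products.  The embeddings are injective, and [Z] is
    unique, because [Yh] is [h]-torsion-free: over the discrete valuation ring
    [K[[h]]] its finitely generated submodules are therefore free. *)
Require Import Defs.
From HB Require Import structures.
From mathcomp Require Import all_boot all_order all_algebra.
From mathcomp Require Import boolp finmap monalg.
From mathcomp Require Import reals complex.

Set Implicit Arguments.
Unset Strict Implicit.
Unset Printing Implicit Defensive.

Import GRing.Theory.
Local Open Scope ring_scope.
Local Open Scope quotient_scope.

(** * Semilinear maps and tensor products *)

(** The scalar map is kept explicit because scalars change throughout: [psi] lies over [fps_ev0],
    the embedding of the Yangian into its [h]-extension over [const_h], and [in_u], [in_v] over
    [const_uv]. *)
Definition is_semilinear (R R' : comNzRingType) (sg : R -> R') (M : lmodType R)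
    (M' : lmodType R') (f : M -> M') : Prop :=
  (forall x y, f (x + y) = f x + f y) /\ (forall a x, f (a *: x) = sg a *: f x).

Section Semilinear.
Context (R R' : comNzRingType) (sg : R -> R').

Lemma semilinear0 (M : lmodType R) (M' : lmodType R') (f : M -> M') :
  is_semilinear sg f -> f 0 = 0.
Proof. by case=> fD _; apply: (@addrI _ (f 0)); rewrite -fD !addr0. Qed.

Lemma semilinearN (M : lmodType R) (M' : lmodType R') (f : M -> M') :
  is_semilinear sg f -> forall x, f (- x) = - f x.
Proof.
move=> hf x; apply: (@addrI _ (f x)).
by rewrite -(proj1 hf) !subrr (semilinear0 hf).
Qed.

Lemma semilinear_sum (M : lmodType R) (M' : lmodType R') (f : M -> M') :
  is_semilinear sg f -> forall I r (P : pred I) (F : I -> M),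
  f (\sum_(i <- r | P i) F i) = \sum_(i <- r | P i) f (F i).
Proof. by move=> hf I r P F; apply: big_morph; [case: hf|exact: semilinear0]. Qed.

Lemma shom_semilinear (A : superAlgType R) (B : superAlgType R') (f : A -> B) :
  is_superalg_hom sg f -> is_semilinear sg f.
Proof. by case. Qed.

Context (M N : lmodType R) (M' N' : lmodType R') (f : M -> M') (g : N -> N').
Hypotheses (hf : is_semilinear sg f) (hg : is_semilinear sg g).

Lemma tens_map_bal : balanced (fun m n => f m ⊗ g n : M' ⊗[R'] N').
Proof.
case: hf hg => fD fZ [gD gZ].
split=> [m m' n|m n n'|a m n]; rewrite ?fD ?gD ?fZ ?gZ ?pureDl ?pureDr //.
by rewrite pureZl pureZr.
Qed.

Lemma tens_map_pure m n : tens_map f g (m ⊗ n) = f m ⊗ g n :> M' ⊗[R'] N'.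
Proof. exact: tens_lift_pure tens_map_bal. Qed.

Lemma tens_map_semilinear : is_semilinear sg (tens_map f g : M ⊗[R] N -> M' ⊗[R'] N').
Proof.
split; first exact: tens_liftD tens_map_bal.
apply: tens_liftZ tens_map_bal _ => a m n.
by rewrite (proj2 hf) pureZl.
Qed.

End Semilinear.

Lemma linear_semilinear (R : comNzRingType) (M N : lmodType R) (f : M -> N) :
  linear f -> is_semilinear id f.
Proof.
move=> fL; have f0 : f 0 = 0.
  by apply: (@addIr _ (f 0)); have := fL 1 0 0; rewrite !scale1r addr0 => <-; rewrite add0r.
split=> [x y|a x]; first by have := fL 1 x y; rewrite !scale1r.
by have := fL a x 0; rewrite f0 !addr0.
Qed.

Lemma tens_eq_semilinear (R R' : comNzRingType) (sg : R -> R')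
    (M N : lmodType R) (P : lmodType R') (F G : M ⊗[R] N -> P) :
  is_semilinear sg F -> is_semilinear sg G ->
  (forall m n, F (m ⊗ n) = G (m ⊗ n)) -> F =1 G.
Proof.
move=> hF hG FG; apply: tens_ind => // [|x y hx hy].
  by rewrite (semilinear0 hF) (semilinear0 hG).
by rewrite (proj1 hF) (proj1 hG) hx hy.
Qed.

Section TensorHom.
Context (R R' : comNzRingType) (sg : {rmorphism R -> R'}).
Context (A B : superAlgType R) (A' B' : superAlgType R') (f : A -> A') (g : B -> B').
Hypotheses (hf : is_superalg_hom sg f) (hg : is_superalg_hom sg g).

Lemma shom_homog p x : homog p x -> homog p (f x).
Proof. by rewrite /homog -(shom_hpart hf) => ->. Qed.

Let F : A ⊗[R] B -> A' ⊗[R'] B' := tens_map f g.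
Let hF : is_semilinear sg F := tens_map_semilinear (shom_semilinear hf) (shom_semilinear hg).

Lemma tens_map_mul x y : F (x *s y) = F x *s F y.
Proof.
elim/tens_hind: x => [|x x' h h'|p q a b ha hb].
- by rewrite smul0x (semilinear0 hF) smul0x.
- by rewrite smulDl !(proj1 hF) smulDl h h'.
elim/tens_hind: y => [|x x' h h'|p' q' a' b' ha' hb'].
- by rewrite smulx0 (semilinear0 hF) smulx0.
- by rewrite smulDr !(proj1 hF) smulDr h h'.
rewrite [_ *s _](tens_mul_pure _ _ hb ha') (proj2 hF) rmorph_sign.
have E m n : F (m ⊗ n) = f m ⊗ g n
  by exact: (tens_map_pure (shom_semilinear hf) (shom_semilinear hg)).
have ha'' : homog p' (f a') by exact: shom_homog.
have hb'' : homog q (g b) by rewrite /homog -(shom_hpart hg) hb.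
by rewrite !E [RHS](tens_mul_pure _ _ hb'' ha'') (shom_mul hf) (shom_mul hg).
Qed.

Lemma tens_map_one : F sone = sone.
Proof.
rewrite [F _](tens_map_pure (shom_semilinear hf) (shom_semilinear hg)).
by rewrite (shom_one hf) (shom_one hg).
Qed.

End TensorHom.

Section Flip.
Context (R : comNzRingType).

Section FlipModule.
Context (M N : superModType R).

Let fl (m : M) (n : N) : N ⊗[R] M := \sum_(p : bool) \sum_(q : bool)
    (-1) ^+ (p && q) *: (hpart q n ⊗ hpart p m).

Lemma tens_flip_bal : balanced fl.
Proof.
split=> [m m' n|m n n'|a m n]; rewrite /fl -?big_split; apply: eq_bigr => p _ /=;
  rewrite -?big_split; apply: eq_bigr => q _ /=.
- by rewrite linearD pureDr scalerDr.
- by rewrite linearD pureDl scalerDr.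
- by rewrite !linearZ /= pureZr pureZl.
Qed.

Lemma tens_flip_semilinear : is_semilinear id (@tens_flip R M N).
Proof.
split; first exact: tens_liftD tens_flip_bal.
apply: tens_liftZ tens_flip_bal _ => a m n.
rewrite scaler_sumr; apply: eq_bigr => p _; rewrite scaler_sumr; apply: eq_bigr => q _.
by rewrite linearZ /= pureZr !scalerA mulrC.
Qed.

Lemma tens_flip_pure p q (m : M) (n : N) : homog p m -> homog q n ->
  tens_flip (m ⊗ n) = (-1) ^+ (p && q) *: (n ⊗ m).
Proof.
move=> hm hn; rewrite /tens_flip (tens_lift_pure _ _ tens_flip_bal) /fl.
rewrite (bigD1 p) //= (bigD1 q) //= big1 ?addr0 => [|q' /negbTE nq].
  rewrite big1 ?addr0 ?hm ?hn // => p' /negbTE np; rewrite big1 // => q' _.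
  by rewrite (homog_hpart _ hm) np pure0r scaler0.
by rewrite (homog_hpart _ hn) nq pure0l scaler0.
Qed.

End FlipModule.

(** On homogeneous tensors the sign of exchanging the two products cancels against the signs of the
    two multiplications. This makes [Delta°] multiplicative. *)
Lemma tens_flip_mul (A B : superAlgType R) (x y : A ⊗[R] B) :
  tens_flip (x *s y) = tens_flip x *s tens_flip y.
Proof.
have hF := tens_flip_semilinear A B.
elim/tens_hind: x => [|x x' h h'|p q a b ha hb].
- by rewrite smul0x (semilinear0 hF) smul0x.
- by rewrite smulDl !(proj1 hF) smulDl h h'.
elim/tens_hind: y => [|x x' h h'|p' q' a' b' ha' hb'].
- by rewrite smulx0 (semilinear0 hF) smulx0.
- by rewrite smulDr !(proj1 hF) smulDr h h'.
rewrite [_ *s _](tens_mul_pure _ _ hb ha') (proj2 hF).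
rewrite (tens_flip_pure (homogM ha ha') (homogM hb hb')).
rewrite (tens_flip_pure ha hb) (tens_flip_pure ha' hb') smulZl smulZr.
have -> : (b ⊗ a) *s (b' ⊗ a') = _ := tens_mul_pure b a' ha hb'.
rewrite !scalerA -!signr_addb; congr (_ *: _).
by case: p {ha}; case: p' {ha'}; case: q {hb}; case: q' {hb'}.
Qed.

End Flip.

(** * Locally free modules and injectivity of tensor products of maps *)

Section LocallyFree.
Context (R : comNzRingType) (M : lmodType R).

Definition lin_indep n (e : 'I_n -> M) : Prop :=
  forall c : 'I_n -> R, \sum_i c i *: e i = 0 -> forall i, c i = 0.

Definition in_span n (e : 'I_n -> M) (m : M) : Prop :=
  exists c : 'I_n -> R, m = \sum_i c i *: e i.

(** This takes the place of flatness: it is what makes tensoring with [M] preserve injectivity. The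
    independent family need not lie in the span of [G]. *)
Definition locally_free : Prop := forall G : seq M,
  exists n (e : 'I_n -> M), lin_indep e /\ forall m, m \in G -> in_span e m.

Lemma in_spanD n (e : 'I_n -> M) m m' : in_span e m -> in_span e m' -> in_span e (m + m').
Proof.
move=> [c ->] [c' ->]; exists (fun i => c i + c' i).
by rewrite -big_split; apply: eq_bigr => i _; rewrite scalerDl.
Qed.

Lemma in_spanZ n (e : 'I_n -> M) a m : in_span e m -> in_span e (a *: m).
Proof.
move=> [c ->]; exists (fun i => a * c i).
by rewrite scaler_sumr; apply: eq_bigr => i _; rewrite scalerA.
Qed.

Lemma in_span0 n (e : 'I_n -> M) : in_span e 0.
Proof. by exists (fun=> 0); rewrite big1 // => i _; rewrite scale0r. Qed.

Lemma in_span_sum n (e : 'I_n -> M) k (F : 'I_k -> M) :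
  (forall i, in_span e (F i)) -> in_span e (\sum_i F i).
Proof.
by move=> h; apply: big_ind => [||i _]; [exact: in_span0|exact: in_spanD|exact: h].
Qed.

Lemma in_span_gen n (e : 'I_n -> M) i : in_span e (e i).
Proof.
exists (fun j => (j == i)%:R); rewrite (bigD1 i) //= eqxx scale1r big1 ?addr0 //.
by move=> j /negbTE ->; rewrite scale0r.
Qed.

(** Coordinates are packaged as a total function of [m], meaningless off the span, so that they can
    be fed to maps out of a tensor product. *)
Lemma lin_indep_coords n (e : 'I_n -> M) : lin_indep e ->
  exists c : M -> 'I_n -> R, forall m, in_span e m ->
    (forall d, m = \sum_i d i *: e i -> c m =1 d) /\ m = \sum_i c m i *: e i.
Proof.
move=> he.
have H m : exists c : 'I_n -> R, in_span e m -> m = \sum_i c i *: e i.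
  case: (pselect (in_span e m)) => [[c hc]|h]; last by exists (fun=> 0).
  by exists c.
exists (fun m => projT1 (cid (H m))) => m hm.
case: cid => c /= /(_ hm) mc; split=> // d md i; apply/eqP; rewrite -subr_eq0; apply/eqP.
apply: (he (fun i => c i - d i)).
rewrite (eq_bigr (fun i => c i *: e i - d i *: e i)) => [|j _]; last exact: scalerBl.
by rewrite sumrB -mc -md subrr.
Qed.

(* Every family spans the same module as an independent one as soon as each
   nontrivial relation can be normalized to solve for one of the generators. *)
Lemma locally_free_relations :
  (forall n (e : 'I_n -> M) (a : 'I_n -> R), \sum_i a i *: e i = 0 ->
     (exists i, a i <> 0) ->
     exists (b : 'I_n -> R) i, \sum_i b i *: e i = 0 /\ b i = 1) ->
  locally_free.
Proof.
move=> norm_rel.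
have main n (e : 'I_n -> M) : exists n' (e' : 'I_n' -> M),
    lin_indep e' /\ forall m, in_span e m -> in_span e' m.
  elim: n e => [|n IH] e; first by exists 0%N, e; split=> // c _ [].
  case: (pselect (lin_indep e)) => [he|]; first by exists n.+1, e.
  move=> /existsNP [a] /not_implyP [ha] /existsNP [i hi].
  have [b [j [hb bj]]] := norm_rel _ _ _ ha (ex_intro _ i hi).
  have [n' [e' [he' hs]]] := IH (fun k => e (lift j k)).
  exists n', e'; split=> // m [c ->]; apply: in_span_sum => k.
  apply/in_spanZ/hs; case: (unliftP j k) => [l ->|->]; first exact: in_span_gen.
  exists (fun l => - b (lift j l)); apply/eqP.
  move: hb; rewrite (bigD1_ord j) //= bj scale1r => /eqP; rewrite addr_eq0 => /eqP ->.
  by rewrite -sumrN; apply/eqP/eq_bigr => l _; rewrite scaleNr.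
move=> G; have [n [e [he hs]]] := main _ (fun i : 'I_(size G) => G`_i).
exists n, e; split=> // m mG; apply: hs.
have ltm : (index m G < size G)%N by rewrite index_mem.
by rewrite -[m](nth_index 0 mG); exact: (in_span_gen (fun i : 'I_(size G) => G`_i) (Ordinal ltm)).
Qed.

(* An equality of tensors is witnessed inside a finitely generated submodule. *)
Lemma tens_eqv_local (N : lmodType R) (s t : seq (M * N)) : tens_eqv s t ->
  exists G : seq M, forall (S : M -> Prop) (P : zmodType) (f : M -> N -> P),
    S 0 -> (forall m, m \in G -> S m) ->
    (forall m m' n, S m -> S m' -> f (m + m') n = f m n + f m' n) ->
    (forall m n n', S m -> f m (n + n') = f m n + f m n') ->
    (forall a m n, S m -> f (a *: m) n = f m (a *: n)) ->
  \sum_(t <- s) f t.1 t.2 = \sum_(t <- t) f t.1 t.2.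
Proof.
elim=> {s t}
  [s|s t _ [G h]|s t u _ [G h] _ [G' h']|s s' t t' _ [G h] _ [G' h']|s t|n|m m' n|m n n'|a m n].
- by exists [::].
- by exists G => S P f *; rewrite (h S).
- exists (G ++ G') => S P f S0 hG *; rewrite (h S) ?(h' S) // => m mG;
  by apply: hG; rewrite mem_cat mG ?orbT.
- exists (G ++ G') => S P f S0 hG *; rewrite !big_cat /=; rewrite (h S) ?(h' S) // => m mG;
  by apply: hG; rewrite mem_cat mG ?orbT.
- by exists [::] => S P f *; rewrite !big_cat /= addrC.
- exists [::] => S P f S0 _ fDl *; rewrite big_seq1 big_nil /=.
  by apply: (@addrI _ (f 0 n)); rewrite -fDl // !addr0.
- exists [:: m; m'] => S P f S0 hG fDl *; rewrite !big_cons !big_nil !addr0 /= fDl //;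
  by apply: hG; rewrite !inE eqxx ?orbT.
- exists [:: m] => S P f S0 hG fDl fDr *; rewrite !big_cons !big_nil !addr0 /= fDr //;
  by apply: hG; rewrite !inE eqxx.
- exists [:: m] => S P f S0 hG fDl fDr fZ; rewrite !big_seq1 /= fZ //;
  by apply: hG; rewrite !inE eqxx.
Qed.

Lemma tens_coords_sum (N : lmodType R) n (e : 'I_n -> M) (c : M -> 'I_n -> R) (s : seq (M * N)) :
  (forall t, t \in s -> t.1 = \sum_i c t.1 i *: e i) ->
  \sum_(t <- s) t.1 ⊗ t.2 = \sum_k e k ⊗ (\sum_(t <- s) c t.1 k *: t.2) :> M ⊗[R] N.
Proof.
move=> hc.
have pure_sumr k (F : M * N -> N) r :
    e k ⊗ (\sum_(t <- r) F t) = \sum_(t <- r) e k ⊗ F t :> M ⊗[R] N.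
  elim: r => [|t r IH]; first by rewrite !big_nil -(scale0r 0) pureZr scale0r.
  by rewrite !big_cons pureDr IH.
rewrite (eq_bigr _ (fun k _ => pure_sumr k _ _)) exchange_big /=.
rewrite big_seq [RHS]big_seq; apply: eq_bigr => t ts.
rewrite {1}(hc _ ts).
rewrite (big_morph (fun m => m ⊗ t.2) (fun a b => pureDl a b _) (_ : 0 ⊗ t.2 = 0)).
  by apply: eq_bigr => k _; rewrite pureZl pureZr.
by rewrite -(scale0r 0) pureZl scale0r.
Qed.

Lemma tens_indep_sum (N : lmodType R) (x : M ⊗[R] N) : locally_free ->
  exists n (e : 'I_n -> M) (y : 'I_n -> N), lin_indep e /\ x = \sum_i e i ⊗ y i.
Proof.
move=> lf; have [n [e [he hs]]] := lf [seq t.1 | t <- repr x].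
have [c hc] := lin_indep_coords he.
exists n, e, (fun k => \sum_(t <- repr x) c t.1 k *: t.2); split=> //.
rewrite {1}(tensE x); apply: tens_coords_sum => t tx.
by apply: (proj2 (hc _ _)); apply: hs; apply: map_f.
Qed.

(** Write a kernel element as [\sum_k e k ⊗ y k] with [e] independent. Taking the [k]-th coordinate
    of its image gives [g (y k) = 0], hence [y k = 0]. *)
Lemma tens_map_id_inj (N N' : lmodType R) (g : N -> N') : locally_free ->
  is_semilinear id g -> injective g ->
  injective (tens_map id g : M ⊗[R] N -> M ⊗[R] N').
Proof.
move=> lf hg ginj.
have hid : is_semilinear id (@id M) by [].
have hF := tens_map_semilinear hid hg.
suff ker x : tens_map id g x = 0 :> M ⊗[R] N' -> x = 0.
  move=> x y xy; apply/eqP; rewrite -subr_eq0; apply/eqP/ker.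
  by rewrite (proj1 hF) (semilinearN hF) xy subrr.
rewrite (tensE x) (semilinear_sum hF).
have -> : \sum_(t <- repr x) tens_map id g (t.1 ⊗ t.2)
    = \pi_(M ⊗[R] N') [seq (t.1, g t.2) | t <- repr x].
  rewrite tens_pi_sum big_map; apply: eq_bigr => t _; exact: tens_map_pure.
move=> x0.
have /eqmodP/asboolP /tens_eqv_local [G hG] :
  \pi_(M ⊗[R] N') [seq (t.1, g t.2) | t <- repr x] = \pi [::] by exact: x0.
(* The span of [e] has to contain both the elements witnessing that the image vanishes and the first
   factors of [x]. *)
have [n [e [he hs]]] := lf (G ++ [seq t.1 | t <- repr x]).
have [c hc] := lin_indep_coords he.
rewrite (@tens_coords_sum _ _ e c) => [|t tx]; last first.
  by apply: (proj2 (hc _ _)); apply: hs; rewrite mem_cat map_f ?orbT.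
rewrite big1 // => k _.
have cD m m' : in_span e m -> in_span e m' -> c (m + m') k = c m k + c m' k.
  move=> hm hm'; apply: (proj1 (hc _ (in_spanD hm hm')) (fun i => c m i + c m' i)).
  rewrite {1}(proj2 (hc _ hm)) {1}(proj2 (hc _ hm')) -big_split.
  by apply: eq_bigr => i _; rewrite scalerDl.
have cZ a m : in_span e m -> c (a *: m) k = a * c m k.
  move=> hm; apply: (proj1 (hc _ (in_spanZ a hm)) (fun i => a * c m i)).
  rewrite {1}(proj2 (hc _ hm)) scaler_sumr.
  by apply: eq_bigr => i _; rewrite scalerA.
(* The [k]-th coordinate is additive and homogeneous only on the span of [e], which is why the
   vanishing had to be localized there. *)
have := hG (in_span e) N' (fun m n => c m k *: n) (in_span0 e).
rewrite big_nil big_map /= => E.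
have -> : \sum_(t <- repr x) c t.1 k *: t.2 = 0.
  apply: ginj; rewrite (semilinear0 hg) (semilinear_sum hg) -[RHS]E.
  - by apply: eq_bigr => t _; rewrite (proj2 hg).
  - by move=> m mG; apply: hs; rewrite mem_cat mG.
  - by move=> m m' p hm hm'; rewrite cD // scalerDl.
  - by move=> *; rewrite scalerDr.
  - by move=> a m p hm; rewrite cZ // scalerA mulrC.
by rewrite -(scale0r 0) pureZr scale0r.
Qed.

End LocallyFree.

Section TensorSwap.
Context (R : comNzRingType).

(* No Koszul sign, unlike [tens_flip]. *)
Definition tens_swap (M N : lmodType R) : M ⊗[R] N -> N ⊗[R] M :=
  tens_lift (fun m n => n ⊗ m).

Lemma tens_swap_bal (M N : lmodType R) : balanced (fun (m : M) (n : N) => n ⊗ m : N ⊗[R] M).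
Proof.
by split=> [m m' n|m n n'|a m n]; rewrite ?pureDl ?pureDr // pureZl pureZr.
Qed.

Lemma tens_swap_pure (M N : lmodType R) (m : M) (n : N) : tens_swap (m ⊗ n) = n ⊗ m.
Proof. exact: tens_lift_pure (tens_swap_bal M N). Qed.

Lemma tens_swap_semilinear (M N : lmodType R) : is_semilinear id (@tens_swap M N).
Proof.
split; first exact: tens_liftD (tens_swap_bal M N).
by apply: tens_liftZ (tens_swap_bal M N) _ => a m n; rewrite pureZr.
Qed.

Lemma semilinear_comp (M1 M2 M3 : lmodType R) (f : M2 -> M3) (g : M1 -> M2) :
  is_semilinear id f -> is_semilinear id g -> is_semilinear id (f \o g).
Proof.
by move=> [fD fZ] [gD gZ]; split=> [x y|a x] /=; rewrite ?gD ?fD ?gZ ?fZ.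
Qed.

Lemma tens_swapK (M N : lmodType R) : cancel (@tens_swap M N) (@tens_swap N M).
Proof.
apply: (@tens_eq_semilinear _ _ id _ _ _ (@tens_swap N M \o @tens_swap M N) id) => //=.
- by apply: semilinear_comp; apply: tens_swap_semilinear.
- by move=> m n; rewrite !tens_swap_pure.
Qed.

(** Factor [f ⊗ g] as [id ⊗ g] followed by [f ⊗ id], the latter being conjugate under the swap to
    [id ⊗ f]. The fixed factors are [M] and [N'], hence the two freeness hypotheses. *)
Lemma tens_map_inj (M N M' N' : lmodType R) (f : M -> M') (g : N -> N') :
  locally_free M -> locally_free N' ->
  is_semilinear id f -> is_semilinear id g -> injective f -> injective g ->
  injective (tens_map f g : M ⊗[R] N -> M' ⊗[R] N').
Proof.
move=> lfM lfN hf hg finj ginj.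
have hid (P : lmodType R) : is_semilinear id (@id P) by [].
have E : tens_map f g =1 @tens_swap N' M' \o tens_map id f \o @tens_swap M N' \o tens_map id g.
  apply: (@tens_eq_semilinear _ _ id).
  - exact: tens_map_semilinear.
  - repeat (apply: semilinear_comp;
      last by (exact: tens_swap_semilinear || exact: tens_map_semilinear)).
    exact: tens_swap_semilinear.
  - move=> m n /=; rewrite (tens_map_pure hf hg) (tens_map_pure (hid _) hg).
    by rewrite tens_swap_pure (tens_map_pure (hid _) hf) tens_swap_pure.
move=> x y; rewrite !E /= => /(can_inj (@tens_swapK _ _)).
move=> /(tens_map_id_inj lfN hf finj) /(can_inj (@tens_swapK _ _)).
exact: (tens_map_id_inj lfM hg ginj).
Qed.

End TensorSwap.

(** * Power series and torsion *)

Lemma field_locally_free (K : fieldType) (M : lmodType K) : locally_free M.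
Proof.
apply: locally_free_relations => n e a ha [i /eqP ai].
exists (fun j => (a i)^-1 * a j), i; split; last by rewrite mulVf.
rewrite (eq_bigr (fun j => (a i)^-1 *: (a j *: e j))) => [|j _]; last by rewrite scalerA.
by rewrite -scaler_sumr ha scaler0.
Qed.

Section FpsUnits.
Context (K : fieldType).

Lemma fps_mulE (f g : fps K) n : (f * g) n = \sum_(i < n.+1) f i * g (n - i)%N.
Proof. by []. Qed.

Lemma hvarM (f : fps K) : hvar K * f = fun n => if n is m.+1 then f m else 0.
Proof.
apply/funext => n; rewrite fps_mulE /hvar; case: n => [|n].
  by rewrite big_ord_recl big_ord0 mul0r addr0.
by rewrite 2!big_ord_recl /= mul0r add0r mul1r big1 ?addr0 ?subn1 // => i _; rewrite mul0r.
Qed.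

(** The coefficients of [1 / f] up to degree [n]. A whole list is built because each coefficient
    depends on all the previous ones. *)
Fixpoint fps_inv_seq (f : fps K) n : seq K :=
  if n is m.+1 then
    let s := fps_inv_seq f m in
    rcons s (- (f 0%N)^-1 * \sum_(i < m.+1) f i.+1 * s`_(m - i))
  else [:: (f 0%N)^-1].

Lemma size_fps_inv_seq f n : size (fps_inv_seq f n) = n.+1.
Proof. by elim: n => //= n IH; rewrite size_rcons IH. Qed.

Lemma nth_fps_inv_seq f m n : (m <= n)%N -> (fps_inv_seq f n)`_m = (fps_inv_seq f m)`_m.
Proof.
elim: n => [|n IH]; first by rewrite leqn0 => /eqP ->.
rewrite leq_eqVlt => /predU1P [-> //|mn].
by rewrite /= nth_rcons size_fps_inv_seq mn IH.
Qed.

Lemma fps_unit (f : fps K) : f 0%N != 0 -> exists g, g * f = 1.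
Proof.
move=> f0; exists (fun n => (fps_inv_seq f n)`_n); rewrite mulrC.
apply/funext => -[|n]; rewrite fps_mulE big_ord_recl /=.
  by rewrite big_ord0 addr0 mulfV.
rewrite nth_rcons size_fps_inv_seq subn0 ltnn eqxx mulrA mulrN mulfV // mulN1r.
apply/eqP; rewrite addrC subr_eq0; apply/eqP/eq_bigr => i _.
by rewrite subSS [in RHS]nth_fps_inv_seq // leq_subr.
Qed.

Lemma fps_divX (f : fps K) v : (forall n, (n < v)%N -> f n = 0) ->
  f = hvar K ^+ v * (fun n => f (n + v)%N).
Proof.
elim: v f => [|v IH] f hf.
  by rewrite expr0 mul1r; apply/funext => n; rewrite addn0.
have E : f = hvar K * (fun n => f n.+1).
  by rewrite hvarM; apply/funext => -[|n //]; exact: hf.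
rewrite {1}E (IH (fun n => f n.+1)) ?exprS ?mulrA; last by move=> n nv; exact: hf.
by congr (_ * _); apply/funext => n; rewrite addnS.
Qed.

(** Torsion-freeness allows cancelling from a relation the largest power of [h] that divides all its
    coefficients. Some coefficient is then a unit of [K[[h]]], and the relation can be
    normalized. *)
Lemma fps_locally_free (M : lmodType (fps K)) :
  (forall x : M, hvar K *: x = 0 -> x = 0) -> locally_free M.
Proof.
move=> tf; have tfX v (x : M) : hvar K ^+ v *: x = 0 -> x = 0.
  by elim: v x => [|v IH] x; rewrite ?scale1r // exprS -scalerA => /tf /IH.
apply: locally_free_relations => n e a ha [i ai].
have [m am] : exists m, a i m <> 0.
  by apply/existsNP => h; apply: ai; apply/funext => m; apply: h.
have exP : exists m, `[< exists i, a i m <> 0 >] by exists m; apply/asboolP; exists i.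
case: (ex_minnP exP) => v /asboolP [j /eqP aj] vmin {i ai m am exP}.
pose b k : fps K := fun m => a k (m + v)%N.
have ab k : a k = hvar K ^+ v * b k.
  apply: fps_divX => m mv; apply: contrapT => am; move: mv; rewrite ltnNge vmin //.
  by apply/asboolP; exists k.
have [g hg] := fps_unit (aj : b j 0%N != 0).
exists (fun k => g * b k), j; split=> //.
rewrite (eq_bigr (fun k => g *: (b k *: e k))) => [|k _]; last by rewrite scalerA.
rewrite -scaler_sumr (tfX v (\sum_k b k *: e k)) ?scaler0 // -[RHS]ha.
by rewrite scaler_sumr; apply: eq_bigr => k _; rewrite ab scalerA.
Qed.

End FpsUnits.

(** * Absence of [h]-torsion, and the embedding of [Yh ⊗ Yh] *)

Section Torsion.
Context (K : fieldType).

(** After swapping the factors, multiplication by [h] is [id ⊗ mulh] over the field [K], and [mulh]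
    is injective because it shifts coefficients. *)
Lemma hext_torsion_free (A : superAlgType K) (x : hext A) : hvar K *: x = 0 -> x = 0.
Proof.
pose mulh (f : fps K) : fps K := hvar K * f.
have hid : is_semilinear id (@id A) by [].
have hmul : is_semilinear id mulh.
  by split=> [f g|a f]; rewrite /mulh ?mulrDr // [LHS]mulrC -fps_scaleAl mulrC.
have hinj : injective mulh.
  move=> f g; rewrite /mulh !hvarM => E; apply/funext => n.
  exact: (congr1 (fun k : fps K => k n.+1) E).
have E : @tens_swap _ (fps K) A \o (fun x : hext A => hvar K *: x)
     =1 tens_map id mulh \o @tens_swap _ (fps K) A.
  apply: (@tens_eq_semilinear _ _ id).
  - apply: (semilinear_comp (tens_swap_semilinear (fps K) A)).
    split=> [y z|a y]; first exact: (hext_scaleDr (hvar K)).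
    exact: (smulZr a (hvar K ⊗ (sone : A)) y).
  - apply: semilinear_comp; [exact: tens_map_semilinear|exact: tens_swap_semilinear].
  - move=> f a /=; rewrite [hvar K *: _]hext_scale_pure !tens_swap_pure.
    by rewrite (tens_map_pure hid hmul).
move=> x0; apply: (can_inj (@tens_swapK _ (fps K) A)).
apply: (tens_map_id_inj (@field_locally_free _ A) hmul hinj).
have := E x; rewrite /= x0 => <-.
rewrite (semilinear0 (tens_swap_semilinear _ _)).
by rewrite (semilinear0 (tens_map_semilinear hid hmul)).
Qed.

Context (N : nat).
Local Notation Yh := (Yh N K).

Lemma Yh_torsion_free (X : Yh) : hvar K *: X = 0 -> X = 0.
Proof.
move=> h; apply: val_inj; apply: (@hext_torsion_free (yang N K)).
exact: (congr1 val h).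
Qed.

Lemma Yh_locally_free : locally_free Yh.
Proof. exact: (fps_locally_free Yh_torsion_free). Qed.

Lemma Yh_val_hom : is_superalg_hom id (@Yh_val N K).
Proof. by []. Qed.

(** An inclusion need not stay injective after tensoring; here [Yh] and the ambient algebra are both
    torsion-free over [K[[h]]], hence locally free. *)
Lemma Yh2_val_inj : injective (tens_map (@Yh_val N K) (@Yh_val N K)
  : Yh ⊗[fps K] Yh -> hext (yang N K) ⊗[fps K] hext (yang N K)).
Proof.
have h := shom_semilinear Yh_val_hom.
apply: tens_map_inj => //; last by exact: val_inj. exact: Yh_locally_free.
- apply: fps_locally_free. exact: hext_torsion_free.
- exact: val_inj.
Qed.

(** On [Yh ⊗ Yh] the scalar [h] acts as [id ⊗ h], a tensor product of injective maps. This is what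
    makes division by [h] well defined. *)
Lemma Yh2_torsion_free (Z Z' : Yh ⊗[fps K] Yh) : hvar K *: Z = hvar K *: Z' -> Z = Z'.
Proof.
have hid : is_semilinear id (@id Yh) by [].
have hs : is_semilinear id (fun X : Yh => hvar K *: X).
  by split=> [X Y|a X]; rewrite ?scalerDr // !scalerA mulrC.
have sinj : injective (fun X : Yh => hvar K *: X).
  move=> X Y /= XY; apply/eqP; rewrite -subr_eq0; apply/eqP/Yh_torsion_free.
  by rewrite scalerBr XY subrr.
have E : (fun Z : Yh ⊗[fps K] Yh => hvar K *: Z) =1 tens_map id (fun X : Yh => hvar K *: X).
  apply: (@tens_eq_semilinear _ _ id).
  - by split=> [X Y|a X]; rewrite ?scalerDr // !scalerA mulrC.
  - exact: tens_map_semilinear.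
  - by move=> m n; rewrite (tens_map_pure hid hs) pureZr.
have := tens_map_id_inj Yh_locally_free hs sinj.
by move=> inj ZZ'; apply: inj; rewrite -!E.
Qed.

End Torsion.

(** * Commutators with the r-matrix *)

Lemma sbracket_even (R : comNzRingType) (A : superAlgType R) (x y : A) :
  homog false y -> sbracket x y = x *s y - y *s x.
Proof.
move=> hy; rewrite /sbracket.
have E p : \sum_(q : bool) (hpart p x *s hpart q y - (-1) ^+ (p && q) *: (hpart q y *s hpart p x))
    = hpart p x *s y - y *s hpart p x.
  rewrite big_bool /= !(homog_hpart _ hy) /= smulx0 smul0x scaler0 subr0 add0r.
  by rewrite andbF scale1r.
by rewrite (eq_bigr _ (fun p _ => E p)) sumrB -smul_suml -smul_sumr hpart_bigsum.
Qed.

Section Matunit.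
Context (N : nat) (K : comNzRingType).
Local Notation E := (@matunit N K).

Lemma matunit_mul i j k l : E i j *s E k l = (j == k)%:R *: E i l.
Proof.
rewrite [LHS]mul_delta_mx_cond (inj_eq enum_rank_inj).
by case: (j == k); rewrite ?scale1r ?scale0r.
Qed.

Lemma homog_matunit i j : homog (bar i (+) bar j) (E i j).
Proof.
apply/matrixP => a b; rewrite !mxE.
case: eqP => // n; case: eqP => // ai; case: eqP => // bj.
by case: n; rewrite ai bj !enum_rankK.
Qed.

Lemma scaler_swap (V : lmodType K) a b (v : V) : a *: (b *: v) = b *: (a *: v).
Proof. by rewrite !scalerA mulrC. Qed.

Lemma sum_scale_eq (T : finType) (V : lmodType K) (x : T) (F : T -> V) :
  \sum_y (x == y)%:R *: F y = F x.
Proof.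
rewrite (bigD1 x) //= eqxx scale1r big1 ?addr0 // => y /negbTE.
by rewrite eq_sym => ->; rewrite scale0r.
Qed.

Lemma sum_ineg (V : zmodType) (F : idx N -> V) : \sum_k F k = \sum_k F (ineg k).
Proof. exact: (reindex_inj (inv_inj (@inegK N))). Qed.

Lemma bar_ineg (i : idx N) : bar (ineg i) = ~~ bar i.
Proof. by []. Qed.

Local Notation G2 := (gl N K ⊗[K] gl N K).

(* This acts on [K^(N|N) ⊗ K^(N|N)] as the super-permutation. *)
Definition perm_tens : G2 := \sum_i \sum_j (-1) ^+ bar j *: (E i j ⊗ E j i).

(* The image of [perm_tens] under [id ⊗ eta]. *)
Definition perm_tens_eta : G2 :=
  \sum_i \sum_j (-1) ^+ bar j *: (E i j ⊗ E (ineg j) (ineg i)).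

(** The Koszul sign of exchanging [E a k] and [E k b], times [(-1)^(bar k)]. *)
Definition swap_sign (a b k : idx N) : bool :=
  bar k (+) ((bar b (+) bar k) && (bar a (+) bar k)).

Definition perm_comm a b : G2 :=
  \sum_k ((-1) ^+ bar k *: (E a k ⊗ E k b)
          - (-1) ^+ swap_sign a b k *: (E k b ⊗ E a k)).

Definition perm_comm_eta a b : G2 :=
  \sum_k ((-1) ^+ bar k *: (E a k ⊗ E (ineg k) (ineg b))
          - (-1) ^+ swap_sign a b k *: (E k b ⊗ E (ineg a) (ineg k))).

Lemma matunit_lM a b i j k l :
  (E a b ⊗ sone : G2) *s (E i j ⊗ E k l) = (b == i)%:R *: (E a j ⊗ E k l).
Proof.
rewrite [LHS](tens_mul_pure _ _ (homog1 _) (homog_matunit i j)) andbF scale1r.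
by rewrite matunit_mul smul1x pureZl.
Qed.

Lemma matunit_rM a b i j k l :
  (sone ⊗ E a b : G2) *s (E i j ⊗ E k l)
  = (b == k)%:R *: ((-1) ^+ ((bar i (+) bar j) && (bar a (+) bar b)) *: (E i j ⊗ E a l)).
Proof.
rewrite [LHS](tens_mul_pure _ _ (homog_matunit a b) (homog_matunit i j)).
by rewrite matunit_mul smul1x pureZr !scalerA mulrC.
Qed.

Lemma matunit_Ml a b i j k l :
  (E i j ⊗ E k l : G2) *s (E a b ⊗ sone)
  = (j == a)%:R *: ((-1) ^+ ((bar a (+) bar b) && (bar k (+) bar l)) *: (E i b ⊗ E k l)).
Proof.
rewrite [LHS](tens_mul_pure _ _ (homog_matunit k l) (homog_matunit a b)).
by rewrite matunit_mul smulx1 pureZl !scalerA mulrC.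
Qed.

Lemma matunit_Mr a b i j k l :
  (E i j ⊗ E k l : G2) *s (sone ⊗ E a b) = (l == a)%:R *: (E i j ⊗ E k b).
Proof.
rewrite [LHS](tens_mul_pure _ _ (homog_matunit k l) (homog1 _)) scale1r.
by rewrite matunit_mul smulx1 pureZr.
Qed.

(** The commutator without sign; against the even r-matrix it agrees with the supercommutator, by
    [sbracket_even]. *)
Definition acomm (x y : G2) : G2 := x *s y - y *s x.

Lemma smul_sum2 (T : finType) (x : G2) (F : T -> T -> G2) :
  x *s (\sum_i \sum_j F i j) = \sum_i \sum_j x *s F i j.
Proof. by rewrite smul_sumr; apply: eq_bigr => i _; rewrite smul_sumr. Qed.

Lemma smul_sum2l (T : finType) (x : G2) (F : T -> T -> G2) :
  (\sum_i \sum_j F i j) *s x = \sum_i \sum_j F i j *s x.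
Proof. by rewrite smul_suml; apply: eq_bigr => i _; rewrite smul_suml. Qed.

(** Distribute the product over the double sum and bring the Kronecker delta outermost, ready for
    [sum_scale_eq]. *)
Ltac collapse rule :=
  rewrite ?smul_sum2 ?smul_sum2l;
  under eq_bigr => i _ do (under eq_bigr => j _ do
    (rewrite ?smulZl ?smulZr rule [_ *: ((_ == _)%:R *: _)]scaler_swap)).

Lemma acomm_perm_l a b : acomm (E a b ⊗ sone) perm_tens = perm_comm a b.
Proof.
rewrite /acomm /perm_tens /perm_comm sumrB; congr (_ - _).
- collapse matunit_lM.
  by rewrite exchange_big; apply: eq_bigr => j _; rewrite sum_scale_eq.
- collapse matunit_Ml.
  apply: eq_bigr => i _; under eq_bigr => j _ do rewrite eq_sym.
  rewrite sum_scale_eq scalerA -signr_addb /swap_sign; congr (_ ^+ _ *: _).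
  by case: (bar a); case: (bar b); case: (bar i).
Qed.

(** Opposite to [acomm_perm_l]: [x ⊗ 1 + 1 ⊗ x] commutes with the super-permutation. *)
Lemma acomm_perm_r a b : acomm (sone ⊗ E a b) perm_tens = - perm_comm a b.
Proof.
rewrite /acomm /perm_tens /perm_comm sumrB opprB; congr (_ - _).
- collapse matunit_rM.
  apply: eq_bigr => i _.
  rewrite sum_scale_eq scalerA -signr_addb /swap_sign; congr (_ ^+ _ *: _).
  by case: (bar a); case: (bar b); case: (bar i).
- collapse matunit_Mr.
  rewrite exchange_big; apply: eq_bigr => j _; under eq_bigr => i _ do rewrite eq_sym.
  by rewrite sum_scale_eq.
Qed.

Lemma acomm_perm_eta_l a b : acomm (E a b ⊗ sone) perm_tens_eta = perm_comm_eta a b.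
Proof.
rewrite /acomm /perm_tens_eta /perm_comm_eta sumrB; congr (_ - _).
- collapse matunit_lM.
  by rewrite exchange_big; apply: eq_bigr => j _; rewrite sum_scale_eq.
- collapse matunit_Ml.
  apply: eq_bigr => i _; under eq_bigr => j _ do rewrite eq_sym.
  rewrite sum_scale_eq scalerA -signr_addb /swap_sign; congr (_ ^+ _ *: _).
  by rewrite !bar_ineg; case: (bar a); case: (bar b); case: (bar i).
Qed.

(** Apply [id ⊗ eta] to [acomm_perm_r]: since [eta] is an involutive automorphism, [1 ⊗ E a b] acts
    here as [1 ⊗ eta (E a b)] does there, whence the negated indices. *)
Lemma acomm_perm_eta_r a b :
  acomm (sone ⊗ E a b) perm_tens_eta = - perm_comm_eta (ineg a) (ineg b).
Proof.
rewrite /acomm /perm_tens_eta /perm_comm_eta sumrB opprB; congr (_ - _).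
- collapse matunit_rM.
  apply: eq_bigr => i _; rewrite sum_ineg; under eq_bigr => j _ do rewrite inegK.
  rewrite sum_scale_eq scalerA -signr_addb /swap_sign !inegK; congr (_ ^+ _ *: _).
  by rewrite !bar_ineg; case: (bar a); case: (bar b); case: (bar i).
- collapse matunit_Mr.
  rewrite exchange_big; apply: eq_bigr => j _; rewrite sum_ineg.
  under eq_bigr => i _ do rewrite inegK eq_sym.
  by rewrite sum_scale_eq inegK.
Qed.

(** Reindexing by [ineg] flips [bar k], which gives the overall minus sign. In this form the terms
    carry the signs of the index pair [(a, b)] and can be compared with those of [curF_at_tens]. *)
Lemma perm_comm_neg a b : perm_comm (ineg a) (ineg b) =
  - \sum_k ((-1) ^+ bar k *: (E (ineg a) (ineg k) ⊗ E (ineg k) (ineg b))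
          - (-1) ^+ swap_sign a b k *: (E (ineg k) (ineg b) ⊗ E (ineg a) (ineg k))).
Proof.
rewrite /perm_comm sum_ineg -sumrN; apply: eq_bigr => k _.
rewrite opprB addrC -!scaleNr -!signrN /swap_sign !bar_ineg.
by case: (bar a); case: (bar b); case: (bar k).
Qed.

Lemma perm_comm_eta_neg a b : perm_comm_eta (ineg a) (ineg b) =
  - \sum_k ((-1) ^+ bar k *: (E (ineg a) (ineg k) ⊗ E k b)
          - (-1) ^+ swap_sign a b k *: (E (ineg k) (ineg b) ⊗ E a k)).
Proof.
rewrite /perm_comm_eta sum_ineg -sumrN; apply: eq_bigr => k _.
rewrite opprB addrC -!scaleNr -!signrN /swap_sign !bar_ineg !inegK.
by case: (bar a); case: (bar b); case: (bar k).
Qed.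

End Matunit.

(** * The commutator with the r-matrix as a geometric sum *)

Section RMatrix.
Context (N : nat) (F : fieldType) (u v : F).
Local Notation E := (@matunit N F).
Local Notation G2 := (gl N F ⊗[F] gl N F).

Definition curF_at (x : F) (i j : idx N) s : gl N F :=
  x ^+ s *: E i j + (- x) ^+ s *: E (ineg i) (ineg j).

(** A pole-free expression for the cobracket of [F_ab^(s)]; the sum over [c] comes from dividing
    differences of [s]-th powers. For [s = 0] it is empty, so the truncation in [s.-1] is
    harmless. *)
Definition curF_comm (a b : idx N) s : G2 :=
  \sum_(c < s) \sum_k
    ((-1) ^+ bar k *: (curF_at u a k (s.-1 - c) ⊗ curF_at v k b c)
     - (-1) ^+ swap_sign a b k *: (curF_at u k b (s.-1 - c) ⊗ curF_at v a k c)).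

Lemma curF_at_tens i j k l s t :
  curF_at u i j s ⊗ curF_at v k l t =
  (u ^+ s * v ^+ t) *: (E i j ⊗ E k l)
  + ((- u) ^+ s * (- v) ^+ t) *:
      (E (ineg i) (ineg j) ⊗ E (ineg k) (ineg l))
  + ((u ^+ s * (- v) ^+ t) *: (E i j ⊗ E (ineg k) (ineg l))
  + ((- u) ^+ s * v ^+ t) *: (E (ineg i) (ineg j) ⊗ E k l)) :> G2.
Proof.
rewrite /curF_at pureDl !pureDr !pureZl !pureZr !scalerA.
by rewrite [X in _ + X]addrC addrACA.
Qed.

Lemma curF_commE a b s : curF_comm a b s =
  \sum_(c < s)
    ((u ^+ (s.-1 - c) * v ^+ c) *: perm_comm F a b
     - ((- u) ^+ (s.-1 - c) * (- v) ^+ c) *: perm_comm F (ineg a) (ineg b)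
     + ((u ^+ (s.-1 - c) * (- v) ^+ c) *: perm_comm_eta F a b
     - ((- u) ^+ (s.-1 - c) * v ^+ c) *: perm_comm_eta F (ineg a) (ineg b))).
Proof.
apply: eq_bigr => c _.
rewrite perm_comm_neg perm_comm_eta_neg !scalerN !opprK.
rewrite /perm_comm /perm_comm_eta !scaler_sumr -!big_split.
apply: eq_bigr => k _ /=; rewrite !curF_at_tens.
rewrite !scalerDr !opprD addrACA [X in X + _]addrACA [X in _ + X]addrACA.
by congr (_ + _ + (_ + _)); rewrite scalerN; congr (_ - _); exact: scaler_swap.
Qed.

(** The commutators with [P] have coefficients [(u^s - v^s) / (u - v)] and the same with both
    variables negated; those with [Q] have [(u^s - (-v)^s) / (u + v)] and likewise. All four are
    geometric sums, matching [curF_commE]. *)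
Lemma acomm_rmat a b s : u - v != 0 -> u + v != 0 ->
  acomm (curF_at u a b s ⊗ sone + sone ⊗ curF_at v a b s)
        ((u - v)^-1 *: perm_tens N F + (u + v)^-1 *: perm_tens_eta N F)
  = curF_comm a b s.
Proof.
move=> uvB uvD; rewrite curF_commE.
have -> : curF_at u a b s ⊗ sone + sone ⊗ curF_at v a b s
  = (u ^+ s *: (E a b ⊗ sone) + v ^+ s *: (sone ⊗ E a b))
    + ((- u) ^+ s *: (E (ineg a) (ineg b) ⊗ sone)
       + (- v) ^+ s *: (sone ⊗ E (ineg a) (ineg b))) :> G2.
  by rewrite pureDl pureDr !pureZl !pureZr addrACA.
have acommDr (X P Q : G2) : acomm X (P + Q) = acomm X P + acomm X Q.
  by rewrite /acomm smulDl smulDr opprD addrACA.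
have acommZr k (X P : G2) : acomm X (k *: P) = k *: acomm X P.
  by rewrite /acomm smulZl smulZr scalerBr.
have acommDl (Y Z P : G2) : acomm (Y + Z) P = acomm Y P + acomm Z P.
  by rewrite /acomm smulDl smulDr opprD addrACA.
have acommZl k (Y P : G2) : acomm (k *: Y) P = k *: acomm Y P.
  by rewrite /acomm smulZl smulZr scalerBr.
rewrite acommDr !acommZr !acommDl !acommZl.
rewrite !acomm_perm_l !acomm_perm_r !acomm_perm_eta_l !acomm_perm_eta_r !inegK.
rewrite big_split /= !sumrB -!scaler_suml.
set c1 := perm_comm _ a b; set c2 := perm_comm _ (ineg a) _.
set c3 := perm_comm_eta _ a b; set c4 := perm_comm_eta _ (ineg a) _.
have geo (x y : F) : x - y != 0 ->
    \sum_(c < s) x ^+ (s.-1 - c) * y ^+ c = (x - y)^-1 * (x ^+ s - y ^+ s).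
  by move=> xy; rewrite subrXX mulKf.
have uvE : - u - - v = - (u - v) by rewrite opprD.
have uvE' : - u - v = - (u + v) by rewrite opprD.
rewrite !geo ?uvE ?uvE' ?opprK ?oppr_eq0 // !invrN !mulNr !scaleNr !opprK -!scalerA -!scalerDr.
rewrite !scalerN -!scalerBl; congr (_ *: _ + _ *: _).
(* In the [Q] part the second tensor factor interchanges [(a, b)] with its negative, so the powers
   of [v] are regrouped before [c3] and [c4] are factored out. *)
by rewrite [X in _ + X]addrC addrACA [X in _ + X]addrC -!scalerBl.
Qed.
End RMatrix.

(** * The cobracket *)

Section Cobracket.
Context (N : nat) (K : fieldType).
Local Notation g := (tcur N K).
Local Notation Kuv := (Kuv K).
Local Notation E := (@matunit N Kuv).
Local Notation G2 := (gl N Kuv ⊗[Kuv] gl N Kuv).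

Definition const_uv (a : K) : Kuv := tofrac (a%:P%:P).

Lemma in_u_semilinear : is_semilinear const_uv (@in_u N K).
Proof.
split=> [x y|a x]; apply/matrixP => i j; rewrite !mxE.
  by rewrite polyCD rmorphD.
by rewrite polyCM rmorphM.
Qed.

Lemma in_v_semilinear : is_semilinear const_uv (@in_v N K).
Proof.
split=> [x y|a x]; apply/matrixP => i j; rewrite !mxE.
  by rewrite !rmorphD.
by rewrite !rmorphM /= map_polyC.
Qed.

Definition entry2 a b c d : G2 -> Kuv := tens_lift (fun X Y : gl N Kuv => X a b * Y c d).

Lemma entry2_bal a b c d : balanced (fun X Y : gl N Kuv => X a b * Y c d).
Proof.
by split=> [m m' n|m n n'|k m n]; rewrite !mxE ?mulrDl ?mulrDr // mulrCA mulrA.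
Qed.

Lemma entry2_sum a b c d n (X Y : 'I_n -> gl N Kuv) :
  entry2 a b c d (\sum_i X i ⊗ Y i) = \sum_i X i a b * Y i c d.
Proof.
have bal := entry2_bal a b c d.
have E0 : entry2 a b c d 0 = 0.
  by apply: (@addrI _ (entry2 a b c d 0)); rewrite -tens_liftD ?addr0.
rewrite /entry2 (big_morph _ (tens_liftD bal) E0); apply: eq_bigr => i _.
exact: tens_lift_pure.
Qed.

(* [K[u] ⊗ K[v]] embeds in [K(u, v)]: expand the first factor along linearly
   independent elements, and compare coefficients of powers of [v]. *)
Lemma in_uv_inj : injective (tens_map (@in_u N K) (@in_v N K) : g ⊗[K] g -> G2).
Proof.
have hF := tens_map_semilinear in_u_semilinear in_v_semilinear.
suff ker x : tens_map (@in_u N K) (@in_v N K) x = 0 :> G2 -> x = 0.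
  move=> x y xy; apply/eqP; rewrite -subr_eq0; apply/eqP/ker.
  by rewrite (proj1 hF) (semilinearN hF) xy subrr.
have [n [e [y [he ->]]]] := tens_indep_sum x (@field_locally_free _ g).
rewrite (semilinear_sum hF).
under eq_bigr => i _ do rewrite (tens_map_pure in_u_semilinear in_v_semilinear).
move=> h0.
suff y0 i : y i = 0 by apply: big1 => i _; rewrite y0 -(scale0r 0) pureZr scale0r.
apply: val_inj; apply/matrixP => c d; apply/polyP => m.
have -> : (tcur_val (0 : g) c d)`_m = 0 by rewrite mxE coef0.
apply: (he (fun i => (tcur_val (y i) c d)`_m)).
apply: val_inj; apply/matrixP => a b.
have := entry2_sum a b c d (fun i => in_u (e i)) (fun i => in_v (y i)).
rewrite h0 /entry2 tens_lift_pi; last exact: entry2_bal.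
rewrite big_nil => /esym.
under eq_bigr => k _ do rewrite !mxE -rmorphM.
(* The outer polynomial variable is [v], so the coefficient of index [m] is a polynomial in [u]: the
   [(a, b)] entry of a [K]-combination of the [e k]. *)
rewrite -rmorph_sum => /eqP; rewrite tofrac_eq0 => /eqP /polyP /(_ m).
rewrite coef0 coef_sum => hs.
transitivity (\sum_k tcur_val (((tcur_val (y k) c d)`_m) *: e k) a b).
  by apply: (big_morph (fun w : g => tcur_val w a b)) => [w z|]; rewrite mxE.
rewrite [RHS]mxE -[RHS]hs; apply: eq_bigr => k _.
by rewrite mxE coefCM coef_map mulrC.
Qed.

Lemma in_u_curF i j s :
  in_u (curF K i j s) = uvar K ^+ s *: E i j + (- uvar K) ^+ s *: E (ineg i) (ineg j).
Proof.
apply/matrixP => a b; rewrite !mxE polyCD !polyCM rmorphD !rmorphM /=.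
rewrite !polyCMn ?polyC1 !rmorphMn ?rmorph1 //=.
by rewrite !rmorphXn /= rmorphN /= rmorphN.
Qed.

Lemma in_v_curF i j s :
  in_v (curF K i j s) = vvar K ^+ s *: E i j + (- vvar K) ^+ s *: E (ineg i) (ineg j).
Proof.
apply/matrixP => a b; rewrite !mxE !rmorphD !rmorphM /= !rmorph_nat.
by rewrite !rmorphXn /= !rmorphN /= map_polyX.
Qed.

Lemma uvarB_neq0 : uvar K - vvar K != 0.
Proof.
rewrite -rmorphB tofrac_eq0; apply/eqP => /polyP /(_ 1%N) /eqP.
by rewrite coefB coefC coefX coef0 /= sub0r oppr_eq0 oner_eq0.
Qed.

Lemma uvarD_neq0 : uvar K + vvar K != 0.
Proof.
rewrite -rmorphD tofrac_eq0; apply/eqP => /polyP /(_ 1%N) /eqP.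
by rewrite coefD coefC coefX coef0 /= add0r oner_eq0.
Qed.

Lemma rmatE : rmat N K = (uvar K - vvar K)^-1 *: perm_tens N Kuv
  + (uvar K + vvar K)^-1 *: perm_tens_eta N Kuv.
Proof.
rewrite /rmat /perm_tens /perm_tens_eta !scaler_sumr; congr (_ + _);
  apply: eq_bigr => i _; rewrite scaler_sumr; apply: eq_bigr => j _;
  by rewrite scalerA mulrC.
Qed.

Lemma rmat_even : homog false (rmat N K).
Proof.
have sum_even (F : idx N -> idx N -> G2) : (forall i j, homog false (F i j)) ->
    homog false (\sum_i \sum_j F i j).
  by move=> hF; rewrite /homog linear_sum; apply: eq_bigr => i _;
    rewrite /= linear_sum; apply: eq_bigr => j _; apply: hF.
rewrite /rmat; apply: homogD; apply: sum_even => i j; apply: homogZ.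
  rewrite /homog (hpart_pure _ (homog_matunit _ i j) (homog_matunit _ j i)).
  by case: (bar i); case: (bar j).
rewrite /homog (hpart_pure _ (homog_matunit _ i j) (homog_matunit _ (ineg j) (ineg i))).
by rewrite !bar_ineg; case: (bar i); case: (bar j).
Qed.

Definition curF_cobracket (a b : idx N) s : g ⊗[K] g :=
  \sum_(c < s) \sum_k ((-1) ^+ bar k *: (curF K a k (s.-1 - c) ⊗ curF K k b c)
    - (-1) ^+ swap_sign a b k *: (curF K k b (s.-1 - c) ⊗ curF K a k c)).

(** The cobracket is specified only through its image over [K(u, v)]; [acomm_rmat] computes that
    image, and [in_uv_inj] brings the result back to [g ⊗ g]. *)
Lemma cobracket_curF (phi0 : g -> g ⊗[K] g) a b s : is_cobracket phi0 ->
  phi0 (curF K a b s) = curF_cobracket a b s.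
Proof.
move=> hphi; apply: in_uv_inj; rewrite hphi (sbracket_even _ rmat_even).
rewrite rmatE in_u_curF in_v_curF [LHS](acomm_rmat _ _ _ uvarB_neq0 uvarD_neq0).
have hF := tens_map_semilinear in_u_semilinear in_v_semilinear.
rewrite (semilinear_sum hF); apply: eq_bigr => c _.
rewrite (semilinear_sum hF); apply: eq_bigr => k _.
rewrite (proj1 hF) (semilinearN hF) !(proj2 hF) /const_uv !rmorph_sign.
by rewrite !(tens_map_pure in_u_semilinear in_v_semilinear) !in_u_curF !in_v_curF.
Qed.

End Cobracket.

(** * The comultiplication on generators *)

Lemma squot_proj_hom (R : comNzRingType) (A : superAlgType R) (S : A -> Prop) :
  is_superalg_hom id (squot_proj S).
Proof.
split=> //.
- by move=> x y; rewrite linearD.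
- by move=> a x; rewrite linearZ.
- by move=> x y; rewrite -squot_projM.
- by move=> p x; rewrite -squot_proj_hpart.
Qed.

(** Induction on the proof of membership, for all [Y] with value [x] at once, so that [Y] can be
    replaced by any element built with the same value. *)
Lemma gensub_ind (R : comNzRingType) (A : superAlgType R) (S : A -> Prop)
    (P : gensub S -> Prop) :
  P sone -> (forall a X, P X -> P (a *: X)) ->
  (forall X Y, P X -> P Y -> P (X + Y)) -> (forall X Y, P X -> P Y -> P (X *s Y)) ->
  (forall p X, S (gensub_val X) -> P (hpart p X)) -> forall X, P X.
Proof.
move=> P1 PZ PD PM PS X.
have main x : subalg S x -> forall Y : gensub S, gensub_val Y = x -> P Y.
  elim=> {x} [|a x hx IH|x y hx IHx hy IHy|x y hx IHx hy IHy|p x Sx] Y hY.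
  - by have -> : Y = sone by apply: val_inj.
  - have -> : Y = a *: mk_gensub hx by apply: val_inj.
    by apply: PZ; apply: IH.
  - have -> : Y = mk_gensub hx + mk_gensub hy by apply: val_inj.
    by apply: PD; [apply: IHx|apply: IHy].
  - have -> : Y = mk_gensub hx *s mk_gensub hy by apply: val_inj.
    by apply: PM; [apply: IHx|apply: IHy].
  - have -> : Y = hpart p (mk_gensub (subalg_gen1 Sx)) by apply: val_inj.
    exact: PS.
exact: main (gensub_valP X) X erefl.
Qed.

Lemma free_gen_homog (K : comNzRingType) (G : choiceType) (deg : G -> bool) (x : G) :
  homog (deg x) (gen K deg x).
Proof.
apply/malgP => w; rewrite [LHS]free_hpartE; case: eqP => // nw.
rewrite mcoeffU; case: eqP => [wE|_]; last by rewrite mulr0n.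
by case: nw; rewrite -wE /word_deg fmuE big_seq1.
Qed.

Lemma semilinearD (R R' : comNzRingType) (sg : R -> R') (M : lmodType R) (M' : lmodType R')
    (f g : M -> M') :
  is_semilinear sg f -> is_semilinear sg g -> is_semilinear sg (fun x => f x + g x).
Proof.
move=> [fD fZ] [gD gZ]; split=> [x y|a x]; first by rewrite fD gD addrACA.
by rewrite fZ gZ scalerDr.
Qed.

Section Env.
Context (N : nat) (K : comNzRingType).

Lemma env_gen_semilinear p :
  is_semilinear id (fun x : tcur N K => squot_proj (@env_rel N K) (env_gen p x) : env N K).
Proof.
apply: linear_semilinear => a x y.
have hp := shom_semilinear (squot_proj_hom (@env_rel N K)).
rewrite -(proj2 hp a) -(proj1 hp); apply/squot_eqP.
(* The ideal is generated by the homogeneous components of the relations, so the relation [z] is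
   split into its two parts. *)
set z := _ - _; rewrite -(hpart_sum z).
by apply: sideal_add; apply: sideal_gen; exact: env_linear.
Qed.

Lemma env_in_semilinear : is_semilinear id (@env_in N K).
Proof.
have E x : env_in x = squot_proj _ (env_gen false x) + squot_proj _ (env_gen true x) :> env N K.
  exact: (shom_add (squot_proj_hom (@env_rel N K))).
have h := semilinearD (env_gen_semilinear false) (env_gen_semilinear true).
by split=> [x y|a x]; rewrite !E; [exact: (proj1 h)|exact: (proj2 h)].
Qed.

End Env.

(** * Change of scalars between [K] and [K[[h]]] *)

Section Ev0.
Context (K : comNzRingType).

Lemma fps_ev0_zmod : zmod_morphism (@fps_ev0 K).
Proof. by []. Qed.
HB.instance Definition _ := GRing.isZmodMorphism.Build (fps K) K (@fps_ev0 K) fps_ev0_zmod.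

Lemma fps_ev0_monoid : monoid_morphism (@fps_ev0 K).
Proof. by split=> // f g; rewrite /fps_ev0 [LHS]big_ord_recl big_ord0 addr0. Qed.
HB.instance Definition _ := GRing.isMonoidMorphism.Build (fps K) K (@fps_ev0 K) fps_ev0_monoid.

Lemma fps_ev0_hvar : fps_ev0 (hvar K) = 0.
Proof. by []. Qed.

End Ev0.

Definition const_h (K : comNzRingType) (a : K) : fps K := a *: (1 : fps K).

Lemma const_h_zmod (K : comNzRingType) : zmod_morphism (@const_h K).
Proof. by move=> a b; exact: scalerBl. Qed.
HB.instance Definition _ (K : comNzRingType) :=
  GRing.isZmodMorphism.Build K (fps K) (@const_h K) (@const_h_zmod K).

Lemma const_h_monoid (K : comNzRingType) : monoid_morphism (@const_h K).
Proof.
split=> [|a b]; first exact: scale1r.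
by rewrite /const_h -fps_scaleAl mul1r scalerA.
Qed.
HB.instance Definition _ (K : comNzRingType) :=
  GRing.isMonoidMorphism.Build K (fps K) (@const_h K) (@const_h_monoid K).

Lemma hext_pure1_semilinear (K : comNzRingType) (A : superAlgType K) :
  is_semilinear (@const_h K) (fun x : A => hext_pure 1 x).
Proof.
split=> [x y|a x]; first exact: pureDr.
by rewrite [RHS]hext_scale_pure /const_h -fps_scaleAl mul1r /hext_pure pureZr -pureZl.
Qed.

Section GenericComult.
Context (N : nat) (K : comNzRingType) (A : superAlgType K).
Local Notation I := (idx N).
Context (T : I -> I -> nat -> A).

Definition comult_sign (i j k : I) : bool :=
  (bar i (+) bar k) && (bar j (+) bar k).

(** Here [T' i j s] stands for [T_ij^(s+1)], and this is the part of its coproduct free of [T^(0)]: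
    the degrees [a + 1] and [s - a] add up to [s + 1]. *)
Definition comult_tail (R : comNzRingType) (B : lmodType R) (T' : I -> I -> nat -> B) i j s :
    B ⊗[R] B :=
  \sum_k \sum_(a < s) (-1) ^+ comult_sign i j k *: (T' i k a ⊗ T' k j (s.-1 - a)%N).

Lemma comult_split i j s : (forall i j, T i j 0 = (i == j)%:R *: sone) ->
  \sum_k \sum_(a < s.+2) (-1) ^+ comult_sign i j k *: (T i k a ⊗ T k j (s.+1 - a))
  = T i j s.+1 ⊗ sone + sone ⊗ T i j s.+1
    + comult_tail (fun i j s => T i j s.+1) i j s :> A ⊗[K] A.
Proof.
move=> T0.
have E k : \sum_(a < s.+2) (-1) ^+ comult_sign i j k *: (T i k a ⊗ T k j (s.+1 - a)) =
  (j == k)%:R *: (T i k s.+1 ⊗ sone) + (i == k)%:R *: (sone ⊗ T k j s.+1)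
    + \sum_(a < s) (-1) ^+ comult_sign i j k *: (T i k a.+1 ⊗ T k j (s.-1 - a).+1)
    :> A ⊗[K] A.
  rewrite big_ord_recl big_ord_recr /= addrA addrAC [X in X + _]addrC.
  congr (_ + _ + _).
  - rewrite subnn T0 pureZr eq_sym; case: eqVneq => [->|_]; last by rewrite !scale0r scaler0.
    by rewrite /comult_sign addbb andbF !scale1r.
  - rewrite subn0 T0 pureZl; case: eqVneq => [->|_]; last by rewrite !scale0r scaler0.
    by rewrite /comult_sign addbb !scale1r.
  - apply: eq_bigr => a _; rewrite /bump /= add1n subSS; congr (_ *: (_ ⊗ T _ _ _)).
    by case: (s) a => [[]|n a] //=; rewrite subSn // -ltnS.
by rewrite (eq_bigr _ (fun k _ => E k)) !big_split /= !sum_scale_eq.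
Qed.

Lemma tens_map_comult_tail (R : comNzRingType) (sg : {rmorphism K -> R}) (B : lmodType R)
    (f : A -> B) (T' : I -> I -> nat -> A) i j s :
  is_semilinear sg f ->
  tens_map f f (comult_tail T' i j s) = comult_tail (fun i j s => f (T' i j s)) i j s.
Proof.
move=> hf; have hF := tens_map_semilinear hf hf.
rewrite (semilinear_sum hF); apply: eq_bigr => k _.
rewrite (semilinear_sum hF); apply: eq_bigr => a _.
by rewrite (proj2 hF) (tens_map_pure hf hf) rmorph_sign.
Qed.

End GenericComult.

Section ScaleTail.
Context (N : nat) (K : comNzRingType) (A : superAlgType K).
Local Notation I := (idx N).
Context (T : I -> I -> nat -> A).

Definition hscaled i j s : hext A := hext_pure (hvar K ^+ s) (T i j s).

Lemma hscaledE i j s : hscaled i j s = hvar K ^+ s *: hext_pure 1 (T i j s).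
Proof. by rewrite [RHS]hext_scale_pure mulr1. Qed.

(** The factors absorb [h^a] and [h^(s-1-a)] of [h^s], leaving one [h] over. This spare factor is
    why the coproduct is primitive modulo [h]. *)
Lemma comult_tail_scale i j s :
  hvar K ^+ s *: comult_tail (fun i j s => hext_pure 1 (T i j s)) i j s
  = hvar K *: comult_tail hscaled i j s.
Proof.
rewrite !scaler_sumr; apply: eq_bigr => k _.
rewrite !scaler_sumr; apply: eq_bigr => a _.
rewrite !hscaledE pureZl pureZr !scalerA; congr (_ *: _).
have -> : hvar K ^+ s = hvar K * (hvar K ^+ a * hvar K ^+ (s.-1 - a)).
  by case: s a => [[]|s [a al]] //=; rewrite -exprD subnKC // exprS.
by rewrite -!mulrA; congr (_ * _); rewrite mulrA [RHS]mulrC.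
Qed.

Lemma hext_comult i j s :
  hvar K ^+ s *: tens_map (fun x => hext_pure 1 x) (fun x => hext_pure 1 x)
    (T i j s ⊗ sone + sone ⊗ T i j s + comult_tail T i j s)
  = hscaled i j s ⊗ sone + sone ⊗ hscaled i j s + hvar K *: comult_tail hscaled i j s
  :> hext A ⊗[fps K] hext A.
Proof.
have hp := hext_pure1_semilinear A.
have hP := tens_map_semilinear hp hp.
rewrite !(proj1 hP) !(tens_map_pure hp hp) (tens_map_comult_tail _ _ _ _ hp).
by rewrite !scalerDr comult_tail_scale !hscaledE pureZl pureZr.
Qed.

End ScaleTail.

Section YangianComult.
Context (N : nat) (K : fieldType).
Local Notation I := (idx N).
Local Notation H := (@Hgen N K).

Lemma Hgen_homog i j s : homog (bar i (+) bar j) (H i j s).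
Proof.
apply: val_inj; rewrite /= /Hamb.
have hT : homog (bar i (+) bar j) (Tgen K i j s.+1).
  rewrite /homog -[LHS](shom_hpart (squot_proj_hom _)); congr (squot_proj _ _).
  exact: (free_gen_homog K (@yang_deg N) (i, j, s)).
rewrite [LHS](hpart_pure _ (fps_even (hvar K ^+ s)) hT).
by rewrite addFb eqxx.
Qed.

Lemma comult_ext_pure (D : yang N K -> yang N K ⊗[K] yang N K) f y :
  is_superalg_hom id D ->
  comult_ext D (hext_pure f y)
  = f *: tens_map (fun x => hext_pure 1 x) (fun x => hext_pure 1 x) (D y).
Proof.
move=> hD; have hp := hext_pure1_semilinear (yang N K).
have hF := tens_map_semilinear hp hp.
apply: tens_lift_pure; split=> [m m' n|m n n'|a m n].
- exact: scalerDl.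
- by rewrite (shom_add hD) (proj1 hF) scalerDr.
- rewrite (shom_scale hD) (proj2 hF) scalerA; congr (_ *: _).
  by rewrite /const_h mulrC -fps_scaleAl mul1r.
Qed.

Lemma Tgen0 i j : Tgen K i j 0 = (i == j)%:R *: sone :> yang N K.
Proof. exact: (shom_scale (squot_proj_hom (@yang_rel N K))). Qed.

Lemma Yh_comult_gen DY (Dh : Yh N K -> Yh N K ⊗[fps K] Yh N K) i j s :
  is_yang_comult DY -> is_Yh_comult DY Dh ->
  Dh (H i j s) = H i j s ⊗ sone + sone ⊗ H i j s + hvar K *: comult_tail H i j s.
Proof.
move=> [hDY DYT] [_ hDh]; apply: Yh2_val_inj; rewrite hDh.
have hv := shom_semilinear (@Yh_val_hom K N).
have hV := tens_map_semilinear hv hv.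
transitivity (hvar K ^+ s *: tens_map (fun x => hext_pure 1 x) (fun x => hext_pure 1 x)
    (DY (Tgen K i j s.+1)) : hext (yang N K) ⊗[fps K] hext (yang N K)).
  exact: comult_ext_pure.
rewrite DYT [X in tens_map _ _ X](comult_split _ _ _ Tgen0) hext_comult.
rewrite !(proj1 hV) (proj2 hV) !(tens_map_pure hv hv).
by rewrite (tens_map_comult_tail (sg := idfun) _ _ _ _ hv).
Qed.

End YangianComult.

(** * The classical limit *)

Section ComultSkew.
Context (N : nat) (K : comNzRingType).
Local Notation I := (idx N).

(* The quotient [(Delta - Delta°)/h] at a generator. *)
Definition comult_skew (R : comNzRingType) (B : lmodType R) (T : I -> I -> nat -> B) i j s :
    B ⊗[R] B :=
  \sum_k \sum_(a < s) ((-1) ^+ comult_sign i j k *: (T i k a ⊗ T k j (s.-1 - a)%N)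
    - T k j (s.-1 - a)%N ⊗ T i k a).

(** The sign of the flip equals [comult_sign], so the flipped terms carry no sign. *)
Lemma comult_skewE (A : superAlgType K) (T : I -> I -> nat -> A) i j s :
  (forall i j s, homog (bar i (+) bar j) (T i j s)) ->
  comult_tail T i j s - tens_flip (comult_tail T i j s) = comult_skew T i j s.
Proof.
move=> hT; have hfl := tens_flip_semilinear A A.
rewrite (semilinear_sum hfl) -sumrB; apply: eq_bigr => k _.
rewrite (semilinear_sum hfl) -sumrB; apply: eq_bigr => a _.
rewrite (proj2 hfl) (tens_flip_pure (hT _ _ _) (hT _ _ _)) scalerA -signr_addb.
rewrite /comult_sign [bar k (+) bar j]addbC addbb scale1r //.
Qed.

Lemma tens_map_comult_skew (R : comNzRingType) (sg : {rmorphism K -> R})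
    (A : lmodType K) (B : lmodType R)
    (f : A -> B) (T : I -> I -> nat -> A) i j s :
  is_semilinear sg f ->
  tens_map f f (comult_skew T i j s) = comult_skew (fun i j s => f (T i j s)) i j s.
Proof.
move=> hf; have hF := tens_map_semilinear hf hf.
rewrite (semilinear_sum hF); apply: eq_bigr => k _.
rewrite (semilinear_sum hF); apply: eq_bigr => a _.
by rewrite (proj1 hF) (semilinearN hF) (proj2 hF) !(tens_map_pure hf hf) rmorph_sign.
Qed.

(** The substitution transposes the indices, so the flipped half of the skew part becomes the first
    half of the cobracket and the other half the second. *)
Lemma comult_skew_cobracket (A : lmodType K) (F : I -> I -> nat -> A) i j s :
  comult_skew (fun i j s => - ((-1) ^+ bar j *: F j i s)) i j s
  = - ((-1) ^+ bar j *: \sum_(c < s) \sum_k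
       ((-1) ^+ bar k *: (F j k (s.-1 - c)%N ⊗ F k i c)
        - (-1) ^+ swap_sign j i k *: (F k i (s.-1 - c)%N ⊗ F j k c))).
Proof.
have pureNN (x y : A) : (- x) ⊗ (- y) = x ⊗ y :> A ⊗[K] A.
  by rewrite -!scaleN1r pureZl pureZr scalerA mulrNN mulr1 scale1r.
rewrite /comult_skew exchange_big /=.
under eq_bigr => c _ do rewrite sumrB.
(* Only the unflipped half is summed in reverse order: there the index [a] is the degree on the
   left, whereas [c] is the degree on the right. *)
rewrite sumrB (reindex_inj rev_ord_inj) /= -sumrB.
rewrite scaler_sumr -sumrN; apply: eq_bigr => c _.
rewrite -sumrB scaler_sumr -sumrN; apply: eq_bigr => k _.
have -> : (s - c.+1)%N = (s.-1 - c)%N by rewrite -subn1 -subnDA add1n.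
have -> : (s.-1 - (s.-1 - c))%N = c by rewrite subKn //; case: (s) c => [[]|n []].
rewrite !pureNN !pureZl !pureZr scalerBr opprB !scalerA -!signr_addb; congr (_ *: _ - _ *: _).
  rewrite /comult_sign /swap_sign.
  by case: (bar i); case: (bar j); case: (bar k).
Qed.

End ComultSkew.

(** * Good elements form the whole of [Yh] *)

Section ClassicalLimit.
Context (K : fieldType) (N : nat).
Context (DeltaU : env N K -> env N K ⊗[K] env N K).
Context (phi0 : tcur N K -> tcur N K ⊗[K] tcur N K) (hphi0 : is_cobracket phi0).
Context (phi : env N K -> env N K ⊗[K] env N K) (hphi : is_coPoisson phi0 DeltaU phi).
Context (DeltaY : yang N K -> yang N K ⊗[K] yang N K) (hDeltaY : is_yang_comult DeltaY).
Context (Delta : Yh N K -> Yh N K ⊗[fps K] Yh N K) (hDelta : is_Yh_comult DeltaY Delta).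
Context (iso : Yh0 N K -> env N K) (hiso : is_classical_limit DeltaU Delta iso).

Let psi (X : Yh N K) : env N K := iso (Yh_proj X).
Let h := hvar K.

Lemma psi_hom : is_superalg_hom (@fps_ev0 K) psi.
Proof.
have [_ hi _ _] := hiso.
have hp : is_superalg_hom id (@Yh_proj N K) by exact: squot_proj_hom.
split=> [x y|a x||x y|p x]; rewrite /psi.
- by rewrite (shom_add hp) (shom_add hi).
- by rewrite (shom_scale hp) (shom_scale hi).
- by rewrite (shom_one hp) (shom_one hi).
- by rewrite (shom_mul hp) (shom_mul hi).
- by rewrite (shom_hpart hp) (shom_hpart hi).
Qed.

Let psi2 : Yh N K ⊗[fps K] Yh N K -> env N K ⊗[K] env N K := tens_map psi psi.

Lemma psi2_semilinear : is_semilinear (@fps_ev0 K) psi2.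
Proof. exact: (tens_map_semilinear (shom_semilinear psi_hom) (shom_semilinear psi_hom)). Qed.

Lemma psi2_mul x y : psi2 (x *s y) = psi2 x *s psi2 y.
Proof. exact: (tens_map_mul psi_hom psi_hom). Qed.

Lemma psi2_h x : psi2 (h *: x) = 0.
Proof. by rewrite (proj2 psi2_semilinear) fps_ev0_hvar scale0r. Qed.

Lemma psi2_Delta X : psi2 (Delta X) = DeltaU (psi X).
Proof. by case: hiso => _ _ ->. Qed.

Let flip := @tens_flip (fps K) (Yh N K) (Yh N K).

Let good (X : Yh N K) : Prop :=
  exists2 Z, h *: Z = Delta X - flip (Delta X) & psi2 Z = phi (psi X).

Lemma phi_linear : is_semilinear id phi.
Proof. by case: hphi => hl _ _; apply: linear_semilinear. Qed.

Lemma good_one : good sone.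
Proof.
have [_ _ phiM] := hphi.
have D1 : Delta sone = sone ⊗ sone := shom_one (proj1 hDelta).
exists 0.
  rewrite scaler0 D1 /flip (tens_flip_pure (homog1 _) (homog1 _)) scale1r.
  by rewrite subrr.
rewrite (semilinear0 psi2_semilinear) (shom_one psi_hom).
have DU1 : DeltaU sone = sone.
  by rewrite -(shom_one psi_hom) -psi2_Delta D1 [LHS](tens_map_one psi_hom psi_hom).
(* The co-Poisson rule at [1 * 1] reads [phi 1 = phi 1 + phi 1], so [phi 1 = 0]. *)
have := phiM sone sone; rewrite !DU1 !smul1x !smulx1 => E.
by apply: (@addrI _ (phi sone)); rewrite -E addr0.
Qed.

Lemma good_scale a X : good X -> good (a *: X).
Proof.
have hfl := tens_flip_semilinear (Yh N K) (Yh N K).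
move=> [Z hZ pZ]; exists (a *: Z).
  by rewrite (shom_scale (proj1 hDelta)) /flip (proj2 hfl) -scalerBr -hZ !scalerA mulrC.
by rewrite (proj2 psi2_semilinear) pZ (shom_scale psi_hom) (proj2 phi_linear).
Qed.

Lemma good_add X Y : good X -> good Y -> good (X + Y).
Proof.
have hfl := tens_flip_semilinear (Yh N K) (Yh N K).
move=> [Z hZ pZ] [W hW pW]; exists (Z + W).
  by rewrite (shom_add (proj1 hDelta)) /flip (proj1 hfl) scalerDr hZ hW opprD addrACA.
by rewrite (proj1 psi2_semilinear) pZ pW (shom_add psi_hom) (proj1 phi_linear).
Qed.

Lemma psi2_flip X : good X -> psi2 (flip (Delta X)) = DeltaU (psi X).
Proof.
move=> [Z hZ _].
have -> : flip (Delta X) = Delta X - h *: Z by rewrite hZ subKr.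
by rewrite (proj1 psi2_semilinear) (semilinearN psi2_semilinear) psi2_h subr0 psi2_Delta.
Qed.

(* [Delta X Delta Y - Delta° X Delta° Y
    = (Delta X - Delta° X) Delta Y + Delta° X (Delta Y - Delta° Y)],
   and modulo [h] both [Delta] and [Delta°] become the comultiplication of
   the enveloping algebra. *)
Lemma good_mul X Y : good X -> good Y -> good (X *s Y).
Proof.
have [_ _ phiM] := hphi.
move=> gX gY; have fX := psi2_flip gX; case: gX gY => [Z hZ pZ] [W hW pW].
exists (Z *s Delta Y + flip (Delta X) *s W).
  rewrite (shom_mul (proj1 hDelta)) /flip tens_flip_mul scalerDr -smulZl -smulZr hZ hW.
  by rewrite smulDl smulDr smulNl smulNr addrA subrK.
by rewrite (proj1 psi2_semilinear) !psi2_mul pZ pW fX (shom_mul psi_hom) phiM psi2_Delta.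
Qed.

(** The primitive part of the coproduct is fixed by the flip and cancels, leaving [h] times
    [comult_skew]. Its image under [psi ⊗ psi] is matched with the explicit cobracket of
    [F_ji^(s)]. *)
Lemma good_gen i j s : good (Hgen K i j s).
Proof.
have [_ phi_in _] := hphi; have [_ _ _ psiH] := hiso.
have hfl := tens_flip_semilinear (Yh N K) (Yh N K).
have hH := @Hgen_homog N K.
exists (comult_skew (@Hgen N K) i j s).
  rewrite (Yh_comult_gen _ _ _ hDeltaY hDelta) -(comult_skewE _ _ _ hH).
  rewrite /flip !(proj1 hfl) (proj2 hfl).
  rewrite (tens_flip_pure (hH _ _ _) (homog1 _)) (tens_flip_pure (homog1 _) (hH _ _ _)).
  by rewrite andbF !scale1r [X in _ - (X + _)]addrC opprD addrACA subrr add0r scalerBr.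
have e := env_in_semilinear N K.
have he := tens_map_semilinear e e.
rewrite [LHS](tens_map_comult_skew (sg := @fps_ev0 K) _ _ _ _ (shom_semilinear psi_hom)).
rewrite {2}/psi psiH (semilinearN phi_linear) (proj2 phi_linear) phi_in.
rewrite (cobracket_curF _ _ _ hphi0).
transitivity (comult_skew (fun i j s => - ((-1) ^+ bar j *: env_in (curF K j i s))) i j s).
  apply: eq_bigr => k _; apply: eq_bigr => a _.
  by rewrite /psi !psiH.
rewrite [LHS]comult_skew_cobracket; congr (- (_ *: _)).
rewrite (semilinear_sum he); apply: eq_bigr => c _.
rewrite (semilinear_sum he); apply: eq_bigr => k _.
by rewrite (proj1 he) (semilinearN he) !(proj2 he) !(tens_map_pure e e).
Qed.

Lemma good_all X : good X.
Proof.
move: X; apply: gensub_ind.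
- exact: good_one.
- exact: good_scale.
- exact: good_add.
- exact: good_mul.
move=> p X [i [j [s hX]]].
have -> : X = Hgen K i j s by apply: val_inj.
(* A generator is homogeneous, so each of its components is the generator itself or zero. *)
rewrite (homog_hpart _ (Hgen_homog K i j s)); case: eqP => _; first exact: good_gen.
by rewrite -(scale0r sone); apply: good_scale; apply: good_one.
Qed.

End ClassicalLimit.

(** Division by [h] is expressed as the existence of a unique [Z] with
    [h Z = Delta X - Delta° X]. *)
Theorem proposition2p4 (R : realType) (N : nat) (hN : (0 < N)%N)
    (DeltaU : env N R[i] -> env N R[i] ⊗[R[i]] env N R[i])
    (hDeltaU : is_env_comult DeltaU)
    (phi0 : tcur N R[i] -> tcur N R[i] ⊗[R[i]] tcur N R[i])
    (hphi0 : is_cobracket phi0)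
    (phi : env N R[i] -> env N R[i] ⊗[R[i]] env N R[i])
    (hphi : is_coPoisson phi0 DeltaU phi)
    (DeltaY : yang N R[i] -> yang N R[i] ⊗[R[i]] yang N R[i])
    (hDeltaY : is_yang_comult DeltaY)
    (Delta : Yh N R[i] -> Yh N R[i] ⊗[fps R[i]] Yh N R[i])
    (hDelta : is_Yh_comult DeltaY Delta)
    (iso : Yh0 N R[i] -> env N R[i])
    (hiso : is_classical_limit DeltaU Delta iso) :
  let psi (X : Yh N R[i]) : env N R[i] := iso (Yh_proj X) in
  forall X : Yh N R[i],
    exists2 Z : Yh N R[i] ⊗[fps R[i]] Yh N R[i],
      unique (fun Z' => hvar R[i] *: Z' = Delta X - tens_flip (Delta X)) Z
      & tens_map psi psi Z = phi (psi X).
Proof.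
move=> psi X; have [Z hZ pZ] := good_all hphi0 hphi hDeltaY hDelta hiso X.
exists Z => //; split=> // Z' hZ'; apply: Yh2_torsion_free.
by rewrite hZ hZ'.
Qed.
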